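(* Let $\gamma\in\mathbb{R}$ and $1\le p<\infty$. There is a constant $C>0$ such that for every radially symmetric $u\in\widetilde W^{1,1}_{loc}$ satisfying either ($\gamma>1-N$ and $u\in\widetilde W^{1,1}_{loc,-}$) or ($\gamma<1-N$ and $u\in\widetilde W^{1,1}_{loc,+}$), one has $\||x|^{N-1+\gamma}u\|_\infty\le C\,\||x|^{\gamma+\frac{N}{p'}}\partial_\rho u\|_p$ (both sides possibly infinite; finiteness of the right-hand side implies finiteness of the left-hand side). Furthermore, if $p=1$, this inequality remains true when $\gamma=1-N$.
   Context: $N\ge1$, $\mathbb{R}^N_*:=\mathbb{R}^N\setminus\{0\}$, $\|\cdot\|_s$ the $L^s(\mathbb{R}^N)$ (quasi-)norm, $p'$ the Hölder conjugate of $p$ ($p'=\infty$ if $p=1$, so $N/p'=0$). For a distribution $u$ on $\mathbb{R}^N_*$, $\partial_\rho u:=\nabla u\cdot\frac{x}{|x|}$. $\widetilde W^{1,1}_{loc}:=\{u\in L^1_{loc}(\mathbb{R}^N_* ):\partial_\rho u\in L^1_{loc}(\mathbb{R}^N_* )\}$. With $\omega_N$ the volume of the unit ball, $f_u(t):=(N\omega_N)^{-1}\int_{\mathbb{S}^{N-1}}u(t\sigma)d\sigma$; for $u\in\widetilde W^{1,1}_{loc}$, $f_{|u|}$ is (has a representative that is) continuous on $(0,\infty)$. $\widetilde W^{1,1}_{loc,-}:=\{u\in\widetilde W^{1,1}_{loc}:\liminf_{t\to\infty}f_{|u|}(t)=0\}$ and $\widetilde W^{1,1}_{loc,+}:=\{u\in\widetilde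 W^{1,1}_{loc}:\liminf_{t\to0^+}f_{|u|}(t)=0\}$. $u$ is radially symmetric if $u(x)$ depends only on $|x|$. *)

(* Defs.v *)
(* R^N is modelled as N.-tuple R
   (with the library's product sigma-algebra on tuples). *)
From HB Require Import structures.
From mathcomp Require Import all_boot all_order all_algebra.
From mathcomp Require Import all_classical all_reals all_analysis.
Set Implicit Arguments.
Unset Strict Implicit.
Unset Printing Implicit Defensive.
Import Order.TTheory GRing.Theory Num.Theory.
Import numFieldNormedType.Exports.
Local Open Scope classical_set_scope.
Local Open Scope ring_scope.

Section RN.
Variable R : realType.

Fixpoint lebN (n : nat) : set (n.-tuple R) -> \bar R :=
  match n with
  | 0%N => fun A => (\1_A [tuple] : R)%:E
  | n'.+1 => fun A =>
      (\int[@lebesgue_measure R]_x @lebN n' [set t : n'.-tuple R | A (cons_tuple x t)])%E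
  end.

Variable N : nat.
Local Notation V := (N.-tuple R).

Definition normN (x : V) : R := Num.sqrt (\sum_(j < N) tnth x j ^+ 2).
Definition subN (x y : V) : V := [tuple tnth x j - tnth y j | j < N].
Definition scaleN (t : R) (x : V) : V := [tuple t * tnth x j | j < N].
Definition shiftN (x : V) (i : 'I_N) (t : R) : V :=
  [tuple tnth x j + (if j == i then t else 0) | j < N].

Definition nullN (A : set V) : Prop :=
  exists B : set V, measurable B /\ @lebN N B = 0%E /\ A `<=` B.

Definition contN (f : V -> R) : Prop :=
  forall x (e : R), 0 < e -> exists2 d : R, 0 < d &
    forall y, normN (subN y x) < d -> `|f y - f x| < e.

Definition pderivN (i : 'I_N) (f : V -> R) : V -> R :=
  fun x => derive1 (fun t : R => f (shiftN x i t)) 0.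

Fixpoint iter_pderivN (s : seq 'I_N) (f : V -> R) : V -> R :=
  match s with
  | [::] => f
  | i :: s' => pderivN i (iter_pderivN s' f)
  end.

Definition smoothN (f : V -> R) : Prop :=
  forall s : seq 'I_N, contN (iter_pderivN s f) /\
    forall (i : 'I_N) (x : V), derivable (fun t : R => iter_pderivN s f (shiftN x i t)) 0 1.

(* test functions: C^infty with compact support in R^N \ {0}
   (i.e. vanishing outside some closed annulus a <= |x| <= b, 0 < a < b) *)
Definition testfunN (phi : V -> R) : Prop :=
  smoothN phi /\ exists a b : R, [/\ 0 < a, a < b &
    forall x, normN x < a \/ b < normN x -> phi x = 0].

(* L^1_loc(R^N \ {0}): measurable and integrable on every compact subset of
   R^N \ {0}, i.e. on every closed annulus *)
Definition L1locN (u : V -> R) : Prop :=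
  measurable_fun setT u /\
  forall a b : R, 0 < a -> a < b ->
    (\int[@lebN N]_(x in [set x | (a <= normN x <= b)%R]) (`|u x|)%:E < +oo)%E.

(* g = d_rho u in the sense of distributions on R^N \ {0}, where
   d_rho u = grad u . x/|x|, i.e.
   <d_rho u, phi> = sum_i <d_i u, x_i phi/|x|> = - int u div(phi x/|x|)
                  = - int u (x/|x| . grad phi + (N-1) phi/|x|). *)
Definition radial_derivN (u g : V -> R) : Prop :=
  forall phi, testfunN phi ->
    (\int[@lebN N]_x (g x * phi x)%:E =
     - \int[@lebN N]_x (u x * ((\sum_(i < N) tnth x i / normN x * pderivN i phi x)
                              + (N%:R - 1) * phi x / normN x))%:E)%E.

Definition tW11loc (u : V -> R) : Prop :=
  L1locN u /\ exists g, L1locN g /\ radial_derivN u g.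

Definition radialN (u : V -> R) : Prop :=
  forall x y, normN x = normN y -> u x = u y.

Definition omegaN : R := fine (@lebN N [set x | normN x < 1]).

Definition sphere_measureN (E : set V) : \bar R :=
  ((N%:R)%:E * @lebN N [set x | (0 < normN x <= 1)%R /\ E (scaleN (normN x)^-1 x)])%E.

Definition sphereN : set V := [set s | normN s = 1].

Definition f_avgN (u : V -> R) (t : R) : \bar R :=
  (((N%:R * omegaN)^-1)%:E * \int[sphere_measureN]_(s in sphereN) (u (scaleN t s))%:E)%E.

Definition liminf_pinfty_eq0 (F : R -> R) : Prop :=
  (forall e : R, 0 < e -> forall M : R, exists t, M < t /\ F t < e) /\
  (forall e : R, 0 < e -> exists M : R, forall t, M < t -> - e < F t).

Definition liminf_0plus_eq0 (F : R -> R) : Prop :=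
  (forall e : R, 0 < e -> forall d : R, 0 < d -> exists t, 0 < t < d /\ F t < e) /\
  (forall e : R, 0 < e -> exists2 d : R, 0 < d & forall t, 0 < t < d -> - e < F t).

Definition cont_rep_f_abs (u : V -> R) (F : R -> R) : Prop :=
  {within [set t : R | 0 < t], continuous F} /\
  {ae @lebesgue_measure R, forall t, 0 < t -> (F t)%:E = f_avgN (fun x => `|u x|) t}.

Definition tW11loc_minus (u : V -> R) : Prop :=
  tW11loc u /\ exists F, cont_rep_f_abs u F /\ liminf_pinfty_eq0 F.

Definition tW11loc_plus (u : V -> R) : Prop :=
  tW11loc u /\ exists F, cont_rep_f_abs u F /\ liminf_0plus_eq0 F.

Definition LinfN (f : V -> R) : \bar R :=
  ereal_inf [set M : \bar R | nullN [set x | (M < (`|f x|)%:E)%E]].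

Definition LpN (p : R) (f : V -> R) : \bar R :=
  poweR (\int[@lebN N]_x ((`|f x| `^ p)%:E)) p^-1.

End RN.

(* Main.v *)
(* A radial u is a function W of |x|^N, and x |-> |x|^N pushes Lebesgue measure
   on R^N to a multiple of Lebesgue measure on the half-line.  Testing the
   definition of the radial derivative g against |x|^(1-N) Psi(|x|^N) gives
     int g |x|^(1-N) Psi(|x|^N) = - N int u Psi'(|x|^N),
   so letting Psi tend to the indicator of [s, t], for Lebesgue points s < t
   of W, yields
     N kappa |W(s) - W(t)| <= int_{s <= |x|^N <= t} |g| |x|^(1-N)
   with kappa the volume of the unit ball.  Hoelder's inequality bounds the right
   member uniformly in t (or in s), and the vanishing liminf removes W(t)
   (or W(s)). *)
Require Import Defs.
From HB Require Import structures.
From mathcomp Require Import all_boot all_order all_algebra.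
From mathcomp Require Import all_classical all_reals all_analysis.
From mathcomp Require Import measurable_realfun ring lra.
Set Implicit Arguments.
Unset Strict Implicit.
Unset Printing Implicit Defensive.
Import Order.TTheory GRing.Theory Num.Theory.
Import numFieldNormedType.Exports.
Local Open Scope classical_set_scope.
Local Open Scope ring_scope.

(** The variable |x|^N, rather than |x|, serves twice: its law is a multiple of one-dimensional
    Lebesgue measure, so no polar coordinates are needed, and x/|x|^N is divergence free off the
    origin, so the term (N-1) phi/|x| cancels. With [decay] = (1-N-gamma)/N, the weight
    |x|^(N-1+gamma) is s^(-decay) at s = |x|^N. For p > 1 Hoelder leaves the integral of r^(decay q
    - 1) over [s, t], q conjugate to p: it is bounded uniformly in t if decay < 0, in s if decay >
    0, and is logarithmic if decay = 0. For p = 1 only the supremum of r^decay on [s, t] enters,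
    which is 1 at decay = 0; hence the critical case. Two obstacles shape the rest. Smoothness means
    that all iterated partial derivatives exist and are continuous, so test functions come from a
    class of explicit formulas closed under differentiation. And increments of W are controlled only
    between Lebesgue points, while the continuous F agrees with the average only almost everywhere;
    continuity of F supplies usable points close to those given by the liminf. *)

Notation pushforward_measure :=
  measure_function_pushforward__canonical__measure_function_Measure.

(** * Lebesgue measure on tuples as a sigma-finite measure *)

Section lebN_measure.
Context {R : realType}.
Notation leb := (@lebesgue_measure R).

Definition tcons n (z : measurableTypeR R * n.-tuple R) : n.+1.-tuple R := cons_tuple z.1 z.2.
Definition tuncons n (x : n.+1.-tuple R) : measurableTypeR R * n.-tuple R :=
  (thead x, [tuple of behead x]).

Lemma tconsK n : cancel (@tcons n) (@tuncons n).
Proof. by move=> [x t]; rewrite /tcons/tuncons/=; congr pair; apply/val_inj. Qed.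

Lemma measurable_tcons n : measurable_fun setT (@tcons n).
Proof.
exact: (@measurable_cons _ _ _ _ fst n snd).
Qed.

Lemma measurable_tuncons n : measurable_fun setT (@tuncons n).
Proof.
apply/measurable_fun_pairP; split; last exact: measurable_behead.
exact: measurable_tnth.
Qed.

Lemma lebNS n A :
  @lebN R n.+1 A = (leb \x @lebN R n)%E (@tcons n @^-1` A).
Proof.
rewrite /=/product_measure1; apply: eq_integral => x _ /=; congr lebN.
by apply/seteqP; split=> t; rewrite /xsection/= inE.
Qed.

(** Stated as the existence of a bundled measure because the product in the inductive step needs a
    sigma-finite second factor, which the induction hypothesis itself provides. *)
Lemma lebN_sigma_finiteE n :
  exists m : {sigma_finite_measure set (n.-tuple R) -> \bar R},
    @lebN R n = m.
Proof.
elim: n => [|n [m lebm]].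
  by exists (\d_([tuple] : 0.-tuple R)); apply/funext => A.
have mt := @measurable_tcons n.
pose mu : {measure set (n.+1.-tuple R) -> \bar R} :=
  pushforward_measure (leb \x m)%E mt.
have fin : sigma_finite setT mu.
  have /sigma_finiteP[F [FT ndF Foo]] := sigma_finiteT leb.
  have /sigma_finiteP[G [GT ndG Goo]] := sigma_finiteT m.
  (* Both exhaustions are nondecreasing, so the larger of the two indices serves both factors. *)
  exists (fun k => @tuncons n @^-1` (F k `*` G k)).
    apply/seteqP; split => // x _.
    have : setT (tuncons x).1 by [].
    have : setT (tuncons x).2 by [].
    rewrite FT GT => -[k _ Gk] [l _ Fl]; exists (maxn k l) => //; split.
      by move: Fl; exact/subsetPset/ndF/leq_maxr.
    by move: Gk; exact/subsetPset/ndG/leq_maxl.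
  move=> k; have [mF Fk] := Foo k; have [mG Gk] := Goo k; split.
    rewrite -[X in measurable X]setTI; apply: measurable_tuncons => //.
    exact: measurableX.
  have -> : mu (@tuncons n @^-1` (F k `*` G k)) = (leb \x m)%E (F k `*` G k).
    congr product_measure1.
    by apply/funext => z; exact: (congr1 (F k `*` G k) (tconsK z)).
  by rewrite product_measure1E// lte_mul_pinfty// ge0_fin_numE.
pose mmu : {sigma_finite_measure set (n.+1.-tuple R) -> \bar R} :=
  HB.pack (mu : set _ -> \bar R) (Measure.class mu) (Measure_isSigmaFinite.Build _ _ _ (mu : set _ -> \bar R) fin).
by exists mmu; apply/funext => A; rewrite lebNS lebm.
Qed.

Variable n : nat.

Let lebN0 : @lebN R n set0 = 0%E.
Proof. by have [m ->] := lebN_sigma_finiteE n. Qed.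

Let lebN_ge0 A : (0 <= @lebN R n A)%E.
Proof. by have [m ->] := lebN_sigma_finiteE n. Qed.

Let lebN_sigma_additive : semi_sigma_additive (@lebN R n).
Proof.
have [m ->] := lebN_sigma_finiteE n; exact: measure_semi_sigma_additive.
Qed.

HB.instance Definition _ := isMeasure.Build _ _ _ (@lebN R n)
  lebN0 lebN_ge0 lebN_sigma_additive.

Let lebN_sigma_finite : sigma_finite setT (@lebN R n).
Proof. by have [m ->] := lebN_sigma_finiteE n; exact: sigma_finiteT. Qed.

HB.instance Definition _ := Measure_isSigmaFinite.Build _ _ _ (@lebN R n)
  lebN_sigma_finite.

End lebN_measure.

(** * Volume under dilations *)

Section scaling.
Context {R : realType}.
Notation leb := (@lebesgue_measure R).

(** By uniqueness of Lebesgue measure: t times its image under x -> t x gives each []a, b]] its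
    length. *)
Lemma lebesgue_measure_scale (t : R) (A : set R) : 0 < t -> measurable A ->
  leb [set x | A (t * x)] = ((t^-1)%:E * leb A)%E.
Proof.
move=> t0 mA.
have mt : measurable_fun (setT : set (measurableTypeR R)) ( *%R t : measurableTypeR R -> measurableTypeR R).
  exact: mulrl_measurable.
pose mu : {measure set (measurableTypeR R) -> \bar R} :=
  mscale (NngNum (ltW t0)) (pushforward_measure leb mt).
have E : leb A = mu A.
  apply: lebesgue_measure_unique => // _ [[a b] _ <-].
  have -> : mu `]a, b]%classic = (t%:E * leb `](a / t)%R, (b / t)%R]%classic)%E.
    congr (_ * leb _)%E.
    apply/seteqP; split=> x /=; rewrite !in_itv/= ltr_pdivrMr// ler_pdivlMr//;
    by rewrite ![x * t]mulrC.
  rewrite !lebesgue_measure_itv/= !lte_fin ltr_pM2r ?invr_gt0//.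
  case: ifPn => _; last by rewrite mule0.
  by rewrite -!EFinD -EFinM; congr EFin; field; rewrite gt_eqF.
rewrite E/= /mscale/= muleA -EFinM mulVf ?gt_eqF// mul1e //.
Qed.

(** Each coordinate contributes one factor t^-1: the induction hypothesis scales the sections, and
    the one-dimensional rule scales the outer integral. *)
Lemma lebN_scale n (t : R) (A : set (n.-tuple R)) : 0 < t -> measurable A ->
  lebN [set x | A (scaleN t x)] = ((t^-1 ^+ n)%:E * lebN A)%E.
Proof.
move=> t0; elim: n A => [|n IH] A mA.
  rewrite expr0 mul1e; congr lebN.
  by apply/funext => x /=; congr A; rewrite [LHS]tuple0 [RHS]tuple0.
have mt := @measurable_tcons _ n.
pose B := @tcons _ n @^-1` A.
have mB : measurable B by rewrite -[B]setTI; exact: mt.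
pose h x := lebN (xsection B x).
have mh : measurable_fun setT h by exact: measurable_fun_xsection.
rewrite !lebNS /product_measure1.
transitivity (\int[leb]_x ((t^-1 ^+ n)%:E * h (t * x)%R))%E.
  apply: eq_integral => x _ /=; rewrite /h -IH; last exact: measurable_xsection.
  congr lebN; apply/seteqP; split=> y; rewrite /xsection/B/= !inE/=;
  by congr A; apply: eq_from_tnth => i; rewrite !tnth_mktuple; case: (unliftP ord0 i) => [j ->|->];
   rewrite ?tnthS ?tnth0// tnth_mktuple.
have mth : measurable_fun setT (fun x => h (t * x)%R).
  by apply: measurableT_comp => //; exact: mulrl_measurable.
rewrite ge0_integralZl//; last first.
- by rewrite lee_fin exprn_ge0// invr_ge0 ltW.
rewrite exprSr EFinM -muleA; congr (_ * _)%E.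
have mt1 : measurable_fun (setT : set (measurableTypeR R)) ( *%R t : measurableTypeR R -> measurableTypeR R).
  exact: mulrl_measurable.
rewrite -(@ge0_integral_pushforward _ _ _ _ _ _ mt1 leb setT h)//.
have t1 : 0 <= t^-1 by rewrite invr_ge0 ltW.
rewrite -(@ge0_integral_mscale _ _ _ leb setT _ (NngNum t1) h)//.
apply: eq_measure_integral => C mC _.
exact: lebesgue_measure_scale.
Qed.

End scaling.

(** * The Euclidean norm *)

Section norm.
Context {R : realType} {N : nat}.
Implicit Types x : N.-tuple R.

Lemma normN_ge0 x : 0 <= normN x. Proof. exact: sqrtr_ge0. Qed.

Lemma normN_sq x : normN x ^+ 2 = \sum_(j < N) tnth x j ^+ 2.
Proof. by rewrite sqr_sqrtr// sumr_ge0// => j _; exact: sqr_ge0. Qed.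

Lemma normN_scale (t : R) x : 0 <= t -> normN (scaleN t x) = t * normN x.
Proof.
move=> t0; rewrite /normN.
under eq_bigr do rewrite tnth_mktuple exprMn.
by rewrite -mulr_sumr sqrtrM ?sqr_ge0// sqrtr_sqr ger0_norm.
Qed.

Lemma measurable_normN : measurable_fun setT (@normN R N).
Proof.
have ms : measurable_fun setT (fun x => \sum_(j < N) tnth x j ^+ 2).
  by apply: measurable_sum => j; apply: measurable_funX; exact: measurable_tnth.
rewrite (_ : @normN R N = fun x => (\sum_(j < N) tnth x j ^+ 2) `^ 2^-1).
  by apply: (@measurableT_comp _ _ _ _ _ _ (@powR R ^~ 2^-1)) => //.
by apply/funext => x; rewrite powR12_sqrt// sumr_ge0// => j _; exact: sqr_ge0.
Qed.

Lemma abs_tnth_le_normN x i : `|tnth x i| <= normN x.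
Proof.
rewrite -ler_sqr ?nnegrE ?normN_ge0// normN_sq real_normK ?num_real//.
by rewrite (bigD1 i)//= lerDl sumr_ge0// => j _; exact: sqr_ge0.
Qed.

(** The crude factor N in place of its square root suffices, since the lemma only serves to put some
    cube inside the unit ball. *)
Lemma normN_le_cube x (e : R) : 0 <= e -> (forall i, `|tnth x i| <= e) ->
  normN x <= N%:R * e.
Proof.
move=> e0 xe; rewrite -ler_sqr ?nnegrE ?normN_ge0 ?mulr_ge0// normN_sq.
rewrite (@le_trans _ _ (\sum_(j < N) e ^+ 2))//.
  apply: ler_sum => j _; rewrite -(real_normK (num_real _)) ler_sqr ?nnegrE//.
rewrite sumr_const card_ord -[leLHS]mulr_natl exprMn; apply: ler_wpM2r; rewrite ?sqr_ge0//.
by rewrite -natrX ler_nat; case: (N) => // n; rewrite expnS leq_pmulr.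
Qed.

End norm.

(** * Volume of balls *)

Section polar.
Context {R : realType}.
Notation leb := (@lebesgue_measure R).

(** Cubes are computed directly from the recursion; a large one shows that the unit ball has finite
    volume, a small one that the volume is positive. *)
Lemma lebN_cube n (e : R) : 0 <= e ->
  lebN [set x : n.-tuple R | forall i, `|tnth x i| <= e] = ((2 * e) ^+ n)%:E /\
  measurable [set x : n.-tuple R | forall i, `|tnth x i| <= e].
Proof.
move=> e0; elim: n => [|n [IH mn]].
  rewrite (_ : [set x : 0.-tuple R | _] = setT).
    by split => //=; rewrite indicE in_setT.
  by apply/seteqP; split => // x _ [].
have E : @tcons R n @^-1` [set x : n.+1.-tuple R | forall i, `|tnth x i| <= e] =
    `[- e, e]%classic `*` [set x : n.-tuple R | forall i, `|tnth x i| <= e].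
  apply/seteqP; split=> [[a t]|[a t] [/= ae te] i] /=.
    move=> at_e; split => /=.
      by have := at_e ord0; rewrite tnth0 ler_norml in_itv.
    by move=> i; have := at_e (lift ord0 i); rewrite tnthS.
  case: (unliftP ord0 i) => [j ->|->]; first by rewrite tnthS.
  by rewrite tnth0 ler_norml; move: ae; rewrite in_itv.
split.
  rewrite lebNS E product_measure1E//= lebesgue_measure_itv/= lte_fin IH exprS EFinM.
  have [->|e_n0] := eqVneq e 0; first by rewrite oppr0 ltxx mulr0.
  have e_gt0 : 0 < e by rewrite lt_def e_n0.
  rewrite (lt_trans _ e_gt0) ?oppr_lt0//.
  by congr (_ * _)%E; rewrite -EFinD; congr EFin; ring.
rewrite (_ : [set x : n.+1.-tuple R | _] =
    @tuncons R n @^-1` (`[- e, e]%classic `*` [set x : n.-tuple R | forall i, `|tnth x i| <= e])).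
  rewrite -[X in measurable X]setTI; apply: measurable_tuncons => //.
  exact: measurableX.
rewrite -E; apply/funext => x.
exact: (congr1 (fun y : n.+1.-tuple R => forall i, `|tnth y i| <= e) (tuple_eta x)).
Qed.

Variable N : nat.
Notation V := (N.-tuple R).

Lemma measurable_normN_le (r : R) : measurable [set x : V | normN x <= r].
Proof.
rewrite (_ : [set x : V | _] = @normN R N @^-1` `]-oo, r]).
  by rewrite -[X in measurable X]setTI; exact: measurable_normN.
by apply/seteqP; split=> x /=; rewrite in_itv.
Qed.

Definition kappa : R := fine (@lebN R N [set x | normN x <= 1]).

Lemma kappaE : @lebN R N [set x | normN x <= 1] = kappa%:E.
Proof.
rewrite fineK// ge0_fin_numE//.
have [cE mc] := @lebN_cube N 1 ler01.
apply: (@le_lt_trans _ _ (((2 * 1) ^+ N)%:E)); last exact: ltry.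
rewrite -cE le_measure ?inE//; first exact: measurable_normN_le.
by move=> x /= x1 i; exact: le_trans (abs_tnth_le_normN x i) x1.
Qed.

Lemma kappa_gt0 : 0 < kappa.
Proof.
(* Half-side 1/(N+1) keeps the denominator nonzero for every N, and N/(N+1) <= 1 puts the cube
   inside the ball. *)
have e0 : (0 : R) < N.+1%:R^-1 by rewrite invr_gt0.
have [cE mc] := @lebN_cube N _ (ltW e0).
rewrite -lte_fin -kappaE.
apply: (@lt_le_trans _ _ (((2 * N.+1%:R^-1) ^+ N)%:E)).
  by rewrite lte_fin exprn_gt0// mulr_gt0.
rewrite -cE le_measure ?inE//; first exact: measurable_normN_le.
move=> x /= xe; apply: (le_trans (normN_le_cube (ltW e0) xe)).
by rewrite ler_pdivrMr ?mul1r ?ler_nat.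
Qed.

Lemma lebN_ball (r : R) : 0 < r ->
  @lebN R N [set x | normN x <= r] = (kappa * r ^+ N)%:E.
Proof.
move=> r0; rewrite (_ : [set x | _] = [set x : V | [set y : V | normN y <= 1] (scaleN r^-1 x)]).
  rewrite lebN_scale ?invr_gt0//; last exact: measurable_normN_le.
  by rewrite invrK kappaE -EFinM mulrC.
apply/seteqP; split=> x /=; rewrite normN_scale ?invr_ge0 ?(ltW r0)//;
by rewrite mulrC ler_pdivrMr// mul1r.
Qed.

End polar.

(** * The law of |x|^N *)

Section radial_pushforward.
Context {R : realType} {N : nat} (N_gt0 : (0 < N)%N).
Notation leb := (@lebesgue_measure R).
Notation V := (N.-tuple R).
Notation K := (@kappa R N).

Definition normNN (x : V) : R := normN x ^+ N.

Lemma normNN_ge0 x : 0 <= normNN x. Proof. by rewrite exprn_ge0// normN_ge0. Qed.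

Lemma measurable_normNN : measurable_fun setT (normNN : V -> measurableTypeR R).
Proof. by apply: measurable_funX; exact: measurable_normN. Qed.

Lemma measurable_preimage_normNN A : measurable A -> measurable (normNN @^-1` A).
Proof. by move=> mA; rewrite -[X in measurable X]setTI; exact: measurable_normNN. Qed.

Lemma powR_root_expn (b : R) : 0 <= b -> (b `^ N%:R^-1) ^+ N = b.
Proof.
by move=> b0; rewrite -powR_mulrn ?powR_ge0// -powRrM mulVf ?powRr1// pnatr_eq0 -lt0n.
Qed.

Lemma powR_expn_root (b : R) : 0 <= b -> (b ^+ N) `^ N%:R^-1 = b.
Proof.
by move=> b0; rewrite -powR_mulrn// -powRrM mulfV ?powRr1// pnatr_eq0 -lt0n.
Qed.

Lemma normNN_le x (c : R) : 0 <= c -> (normNN x <= c) = (normN x <= c `^ N%:R^-1).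
Proof.
move=> c0; rewrite -[in LHS](powR_root_expn c0) /normNN.
by rewrite ler_pXn2r// nnegrE ?normN_ge0// powR_ge0.
Qed.

Lemma lebN_normNN_le (b : R) :
  @lebN R N (normNN @^-1` `]-oo, b]) = (K * Num.max b 0)%:E.
Proof.
have pos (c : R) : 0 < c -> @lebN R N (normNN @^-1` `]-oo, c]) = (K * c)%:E.
  move=> c0; rewrite -[in RHS](powR_root_expn (ltW c0)) -lebN_ball ?powR_gt0//.
  congr lebN; apply/funext => x; rewrite /preimage/mkset in_itv/=.
  by rewrite normNN_le// ltW.
have [b0|b0] := ltP 0 b; first exact: pos.
(* For [b <= 0] the sublevel set lies in every ball around the origin, hence has volume at most e
   for each e > 0. *)
rewrite mulr0; apply/eqP; rewrite eq_le measure_ge0 andbT.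
apply/lee_addgt0Pr => e e0; rewrite add0e.
have e1 : 0 < e / K by rewrite divr_gt0// kappa_gt0.
rewrite (_ : e = K * (e / K)); last by field; rewrite gt_eqF// kappa_gt0.
rewrite -pos// le_measure ?inE//; try exact: measurable_preimage_normNN.
move=> x; rewrite /= !in_itv/= => /le_trans; apply.
exact: le_trans b0 (ltW e1).
Qed.

Lemma lebN_normNN_itv (a b : R) : a <= b ->
  @lebN R N (normNN @^-1` `]a, b]) = (K * (Num.max b 0 - Num.max a 0))%:E.
Proof.
move=> ab.
have -> : normNN @^-1` `]a, b] = normNN @^-1` `]-oo, b] `\` normNN @^-1` `]-oo, a].
  apply/seteqP; split=> x; rewrite /= !in_itv/=.
    by move=> /andP[ax ->]; split => //; apply/negP; rewrite -ltNge.
  by move=> [-> /negP]; rewrite -ltNge => ->.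
rewrite measureD; try exact: measurable_preimage_normNN.
  rewrite setIidr; last by move=> x; rewrite /= !in_itv/= => /le_trans; apply.
  by rewrite -[LHS]/(@lebN R N _ - @lebN R N _)%E !lebN_normNN_le -EFinB -mulrBr.
by rewrite -[ltLHS]/(@lebN R N _) lebN_normNN_le ltry.
Qed.

(** Uniqueness of Lebesgue measure speaks of the whole line, whereas the image measure lives on the
    half-line; [mu] therefore adds Lebesgue measure on the negative half-line to the normalised
    image. *)
Lemma lebN_normNN (A : set R) : measurable A ->
  @lebN R N (normNN @^-1` A) = (K%:E * leb (A `&` `[0%R, +oo[))%E.
Proof.
move=> mA.
have K0 : 0 <= K^-1 by rewrite invr_ge0 ltW// kappa_gt0.
pose D : set (measurableTypeR R) := `]-oo, 0[%classic.
have mD : measurable D by exact: measurable_itv.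
pose mu : {measure set (measurableTypeR R) -> \bar R} :=
  measure_add (mscale (NngNum K0) (pushforward_measure (@lebN R N) measurable_normNN))
    (mrestr leb mD).
have muE B : mu B = ((K^-1)%:E * @lebN R N (normNN @^-1` B) + leb (B `&` D))%E.
  exact: measure_addE.
have E B : measurable B -> leb B = mu B.
  apply: lebesgue_measure_unique => // _ [[a b] _ <-]; rewrite muE /D.
  have [ab|ba] := leP a b; last first.
    rewrite /= set_itv_ge ?bnd_simp -?leNgt ?(ltW ba)//.
    by rewrite preimage_set0 set0I !measure0 mule0 adde0.
  rewrite /= lebN_normNN_itv// -EFinM mulrA mulVf ?gt_eqF ?kappa_gt0// mul1r.
  rewrite lebesgue_measure_itv/= lte_fin.
  have [b0|b0] := ltP b 0.
    rewrite setIidl; last first.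
      by move=> x; rewrite /= !in_itv/= => /andP[_ /le_lt_trans]; apply.
    rewrite lebesgue_measure_itv/= lte_fin.
    by rewrite (max_r (le_trans ab (ltW b0))) subrr add0e.
  have [a0|a0] := ltP a 0.
    rewrite (_ : _ `&` _ = `]a, 0[%classic); last first.
      apply/seteqP; split=> x; rewrite /= !in_itv/=.
        by move=> [/andP[-> _] ->].
      by move=> /andP[-> x0]; rewrite x0 (le_trans (ltW x0)).
    rewrite lebesgue_measure_itv/= lte_fin a0 (lt_le_trans a0 b0).
    by rewrite -!EFinD; congr EFin; ring.
  rewrite (_ : _ `&` _ = set0); last first.
    apply/seteqP; split=> x //; rewrite /= !in_itv/= => -[/andP[ax _] x0].
    by have := le_lt_trans a0 (lt_trans ax x0); rewrite ltxx.
  rewrite measure0 adde0; case: ltP => // ba.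
  by rewrite (le_anti (introT andP (conj ab ba))) subrr.
have EA : normNN @^-1` A = normNN @^-1` (A `&` `[0%R, +oo[).
  apply/seteqP; split=> x /=; last by case.
  by rewrite in_itv/= normNN_ge0.
have mA' : measurable (A `&` `[0%R, +oo[%classic) by apply: measurableI => //; exact: measurable_itv.
rewrite E// muE -EA (_ : _ `&` D = set0).
  by rewrite measure0 adde0 muleA -EFinM mulfV ?mul1e// gt_eqF// kappa_gt0.
apply/seteqP; split=> x //; rewrite /D /= !in_itv/= andbT => -[[_ x0]].
by rewrite ltNge x0.
Qed.

Lemma ge0_integral_normNN (D : set R) (f : R -> \bar R) : measurable D -> D `<=` `[0%R, +oo[ ->
  measurable_fun D f -> {in D, forall y, 0 <= f y}%E ->
  (\int[@lebN R N]_(x in normNN @^-1` D) f (normNN x) = K%:E * \int[leb]_(y in D) f y)%E.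
Proof.
move=> mD D0 mf f0.
rewrite -(@ge0_integral_pushforward _ _ _ _ _ _ measurable_normNN (@lebN R N) D f)//.
have K0 : 0 <= K by rewrite ltW// kappa_gt0.
rewrite -(@ge0_integral_mscale _ _ _ leb D mD (NngNum K0) f)//; last first.
  by move=> x Dx; apply: f0; rewrite inE.
apply: (@eq_measure_integral _ _ _ _ _
  (pushforward_measure (@lebN R N) measurable_normNN)) => A mA AD.
transitivity (K%:E * leb (A `&` `[0%R, +oo[))%E; first exact: lebN_normNN.
by rewrite setIidl// => x /AD/D0.
Qed.

Lemma integral_normNN (D : set R) (f : R -> R) : measurable D -> D `<=` `[0%R, +oo[ ->
  leb.-integrable D (EFin \o f) ->
  (\int[@lebN R N]_(x in normNN @^-1` D) (f (normNN x))%:E = K%:E * \int[leb]_(y in D) (f y)%:E)%E.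
Proof.
move=> mD D0 intf; have mf := measurable_int _ intf.
rewrite integralE [in RHS]integralE muleBr//; last first.
  by apply: fin_num_adde_defr; exact: integrable_pos_fin_num.
congr (_ - _)%E.
  rewrite -ge0_integral_normNN//; first by apply: eq_integral => x _; rewrite !funeposE.
  exact: measurable_funepos.
rewrite -ge0_integral_normNN//; first by apply: eq_integral => x _; rewrite !funenegE.
exact: measurable_funeneg.
Qed.

End radial_pushforward.

(** * Null sets of radii *)

Section radial_null.
Context {R : realType} {N : nat}.
Notation leb := (@lebesgue_measure R).
Notation V := (N.-tuple R).

(* Tonelli over dilations: for fixed x <> 0 the set of t with t |x| in Z is null,
   while all dilates of {|x| in Z} are null together. *)
Lemma lebN_normN_null (Z : set R) : measurable Z -> ~ Z 0 -> leb Z = 0%E ->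
  @lebN R N (@normN R N @^-1` Z) = 0%E.
Proof.
move=> mZ Z0 Z_null.
have mE : measurable (@normN R N @^-1` Z).
  by rewrite -[X in measurable X]setTI; exact: measurable_normN.
pose h (z : measurableTypeR R * V) : R := z.1 * normN z.2.
have mh : measurable_fun setT h.
  apply: measurable_funM; first exact: measurable_fst.
  by apply: (@measurableT_comp _ _ _ _ _ _ (@normN R N)); [exact: measurable_normN|].
pose A := (`[1, 2]%classic `*` setT) `&` h @^-1` Z.
have mA : measurable A.
  apply: measurableI; first by apply: measurableX => //; exact: measurable_itv.
  by rewrite -[X in measurable X]setTI; exact: mh.
have mxA : measurable_fun setT (fun t => @lebN R N (xsection A t)).
  exact: (@measurable_fun_xsection _ _ _ _ _ (@lebN R N) A mA).
have := @indic_fubini_tonelli _ _ _ _ _ leb (@lebN R N) A mA.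
rewrite indic_fubini_tonelli_FE// indic_fubini_tonelli_GE//.
rewrite [RHS]integral0_eq; last first.
  move=> x _ /=; have [x0|x0] := eqVneq (normN x) 0.
    rewrite (_ : ysection _ _ = set0) ?measure0//.
    by apply/seteqP; split => // t; rewrite /ysection/= inE /A/h/= x0 mulr0 => -[].
  have x_gt0 : 0 < normN x by rewrite lt_def x0 normN_ge0.
  apply/eqP; rewrite eq_le measure_ge0 andbT.
  apply: (@le_trans _ _ (leb [set t | Z (normN x * t)])).
    rewrite le_measure ?inE//; first exact: measurable_ysection.
      have := @mulrl_measurable R setT (normN x) measurableT Z mZ.
      by rewrite setTI.
    by move=> t; rewrite /ysection/= inE /A/h/= mulrC => -[].
  by rewrite lebesgue_measure_scale// Z_null mule0.
move=> I0; apply/eqP; rewrite eq_le measure_ge0 andbT.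
have : ((2^-1 ^+ N)%:E * @lebN R N (@normN R N @^-1` Z) <= 0)%E.
  rewrite -[leRHS]I0.
  (* The interval [1, 2] has length 1, and a dilation by t <= 2 divides volumes by at most 2^N; this
     bounds the vanishing Tonelli integral from below. *)
  apply: (@le_trans _ _ (\int[leb]_(t in `[1%R, 2%R]) ((2^-1 ^+ N)%:E * @lebN R N (@normN R N @^-1` Z)))%E).
    rewrite integral_cst/= ?lebesgue_measure_itv//=.
    by rewrite lte_fin ltr1n -EFinD (_ : 2 - 1 = 1) ?mule1; last ring.
  apply: (@le_trans _ _ (\int[leb]_(t in `[1%R, 2%R]) @lebN R N (xsection A t))%E).
    apply: ge0_le_integral => //.
    - by move=> t _; rewrite mule_ge0// lee_fin exprn_ge0.
    - exact: measurable_funTS.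
    move=> t; rewrite /= in_itv/= => /andP[t1 t2].
    have t0 : 0 < t by exact: lt_le_trans t1.
    rewrite (_ : xsection A t = [set x | (@normN R N @^-1` Z) (scaleN t x)]).
      rewrite lebN_scale//; apply: lee_wpmul2r => //.
      rewrite lee_fin lerXn2r ?nnegrE ?invr_ge0 ?(ltW t0)//.
      by rewrite lef_pV2// posrE.
    apply/seteqP; split=> x; rewrite /xsection/= inE /A/h/= normN_scale ?(ltW t0)//.
      by case.
    by rewrite in_itv/= t1 t2.
  apply: ge0_subset_integral => //.
rewrite pmule_rle0 ?lte_fin ?exprn_gt0//.
Qed.

End radial_null.

(** * A smooth step function on the line *)

Section flat.
Context {R : realType}.
Implicit Types (k : nat) (x y : R).

(** The derivatives of exp(-1/y) are linear combinations of members of this family, so the index k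
    lets smoothness be proved by closure under differentiation. *)
Definition flat k y : R := if 0 < y then y^-1 ^+ k * expR (- y^-1) else 0.

Lemma flat_gt0E k y : 0 < y -> flat k y = y^-1 ^+ k * expR (- y^-1).
Proof. by rewrite /flat => ->. Qed.

Lemma flat_le0 k y : y <= 0 -> flat k y = 0.
Proof. by rewrite /flat leNgt; case: (0 < y). Qed.

Lemma flat_ge0 k y : 0 <= flat k y.
Proof.
rewrite /flat; case: ifPn => // y0.
by rewrite mulr_ge0 ?expR_ge0// exprn_ge0// invr_ge0 ltW.
Qed.

Lemma flat_gt0 k y : 0 < y -> 0 < flat k y.
Proof. by move=> y0; rewrite flat_gt0E// mulr_gt0 ?expR_gt0// exprn_gt0// invr_gt0. Qed.

Lemma flatS k y : flat k.+1 y = y^-1 * flat k y.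
Proof. by rewrite /flat; case: ifPn => _; rewrite ?mulr0// exprS mulrA. Qed.

(** With z = 1/y this is z^k <= k! exp(z), one term of the exponential series. *)
Lemma flat_le_fact k y : flat k y <= k`!%:R.
Proof.
have [y0|y0] := ltP 0 y; last by rewrite flat_le0.
rewrite flat_gt0E//; set z := y^-1; have z0 : 0 <= z by rewrite invr_ge0 ltW.
rewrite expRN ler_pdivrMr ?expR_gt0//.
case: k => [|k]; first by rewrite expr0 fact0 mul1r -(expR0 R) ler_expR.
rewrite -ler_pdivrMl ?ltr0n ?fact_gt0// mulrC (le_trans _ (expR_ge1Dxn k z0))//.
by rewrite lerDr.
Qed.

(** Trades one power of 1/y for a factor y, at the price of the bound for [k.+1]; this gives the
    limit 0 at the origin. *)
Lemma flat_le k y : 0 <= y -> flat k y <= k.+1`!%:R * y.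
Proof.
rewrite le_eqVlt => /predU1P[<-|y0]; first by rewrite flat_le0// mulr0.
by rewrite mulrC -ler_pdivrMl// -flatS flat_le_fact.
Qed.

Lemma flat_cvg0 k : flat k h @[h --> (0 : R)] --> (0 : R).
Proof.
apply/cvgrPdist_le => e e0; near=> y; rewrite sub0r normrN.
have [y0|y0] := ltP 0 y; last by rewrite flat_le0// normr0 ltW.
rewrite ger0_norm ?flat_ge0// (le_trans (flat_le k (ltW y0)))//.
rewrite -ler_pdivlMl ?ltr0n ?fact_gt0//.
rewrite (le_trans (ler_norm _))//; near: y.
apply: (@nbhs0_le _ R); rewrite mulr_gt0// invr_gt0 ltr0n fact_gt0//.
Unshelve. all: by end_near. Qed.

Lemma is_derive_flat k x :
  is_derive x 1 (flat k) (flat k.+2 x - k%:R * flat k.+1 x).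
Proof.
have [x0|x0|->] := ltgtP x 0.
- rewrite !flat_le0 ?(ltW x0)// mulr0 subr0.
  apply: (@near_eq_is_derive _ _ _ (cst 0)); rewrite ?oner_eq0//.
  by near=> y; rewrite flat_le0//= ltW//; near: y; exact: lt_nbhsl.
- apply: (@near_eq_is_derive _ _ _ (fun y => y^-1 ^+ k * expR (- y^-1))); rewrite ?oner_eq0//.
    by near=> y; rewrite flat_gt0E//; near: y; exact: lt_nbhsr.
  have dV : is_derive x 1 (fun y : R => y^-1) (- x ^- 2).
    have := @is_deriveV _ idfun x 1 1 (lt0r_neq0 x0) (is_derive_id _ _).
    by rewrite scaler1.
  have := is_deriveX k dV; rewrite exprfctE => dX.
  have dE := is_derive1_comp (is_derive_expR _) (is_deriveN dV).
  apply: (is_derive_eq (is_deriveM dX dE)).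
  rewrite !flat_gt0E// /GRing.scale/= opprK.
  case: k {dX} => [|k]; rewrite ?exprS/=; field; exact: lt0r_neq0.
- rewrite !flat_le0// mulr0 subr0.
  (* The difference quotient of [flat k] at the origin is exactly [flat k.+1], which tends to 0. *)
  have E : (fun h : R => h^-1 *: (flat k (h *: 1 + 0) - flat k 0)) = flat k.+1.
    apply/funext => h; rewrite (@flat_le0 _ 0)// subr0 addr0 /GRing.scale/= mulr1.
    by rewrite flatS.
  have F := flat_cvg0 k.+1.
  split.
    rewrite /derivable/= E; apply/cvg_ex; exists 0.
    by apply: cvg_within_filter.
  by rewrite /derive/= E; apply/cvg_lim => //; apply: cvg_within_filter.
Unshelve. all: by end_near. Qed.

Lemma flat0_le_id y : 0 <= y -> flat 0 y <= y.
Proof. by move=> y0; have := flat_le 0 y0; rewrite mul1r. Qed.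

Lemma continuous_is_derive (f df : R -> R) :
  (forall x, is_derive x 1 f (df x)) -> continuous f.
Proof.
move=> fdf x; apply: differentiable_continuous; apply/derivable1_diffP.
exact: ex_derive.
Qed.

Lemma continuous_flat k : continuous (flat k).
Proof. exact: continuous_is_derive (is_derive_flat k). Qed.

Definition flat_sum y : R := flat 0 y + flat 0 (1 - y).

Lemma flat_sum_gt0 y : 0 < flat_sum y.
Proof.
have [y0|y0] := ltP 0 y; first by rewrite ltr_wpDr ?flat_ge0 ?flat_gt0.
by rewrite ltr_wpDl ?flat_ge0// flat_gt0// subr_gt0 (le_lt_trans y0).
Qed.

Definition step y : R := flat 0 y / flat_sum y.

(** The quotient rule for f/(f + g), where f = [flat 0 y] has derivative [flat 2 y] and g =
    [flat 0 (1 - y)] has derivative [- flat 2 (1 - y)]. *)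
Definition step' y : R :=
  (flat 2 y * flat 0 (1 - y) + flat 0 y * flat 2 (1 - y)) / flat_sum y ^+ 2.

Lemma step_le0 y : y <= 0 -> step y = 0.
Proof. by move=> y0; rewrite /step flat_le0// mul0r. Qed.

Lemma step_ge1 y : 1 <= y -> step y = 1.
Proof.
move=> y1; have := flat_sum_gt0 y.
by rewrite /step /flat_sum (@flat_le0 0 (1 - y)) ?subr_le0// addr0 => /lt0r_neq0/divff.
Qed.

Lemma step_ge0 y : 0 <= step y.
Proof. by rewrite divr_ge0 ?flat_ge0// ltW// flat_sum_gt0. Qed.

Lemma step_le1 y : step y <= 1.
Proof. by rewrite ler_pdivrMr ?flat_sum_gt0// mul1r lerDl flat_ge0. Qed.

Lemma step'_le0 y : y <= 0 -> step' y = 0.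
Proof. by move=> y0; rewrite /step' !(flat_le0 _ y0) !mul0r addr0 mul0r. Qed.

Lemma step'_ge1 y : 1 <= y -> step' y = 0.
Proof.
by move=> y1; rewrite /step' !(@flat_le0 _ (1 - y)) ?subr_le0// !mulr0 addr0 mul0r.
Qed.

Lemma is_derive_step y : is_derive y 1 step (step' y).
Proof.
have d1 : is_derive y 1 (fun z : R => 1 - z) (- 1).
  by have := is_deriveB (is_derive_cst (1 : R) y 1) (is_derive_id y 1); rewrite sub0r.
have d0 := is_derive_flat 0 y.
have d2 := @is_derive1_comp _ (flat 0) (fun z : R => 1 - z) y _ _ (is_derive_flat 0 _) d1.
have ds := is_deriveD d0 d2.
have dV := is_deriveV (lt0r_neq0 (flat_sum_gt0 y)) ds.
apply: (is_derive_eq (is_deriveM d0 dV)).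
rewrite /step' /GRing.scale/= -/(flat_sum y).
have := lt0r_neq0 (flat_sum_gt0 y); rewrite /flat_sum => h.
by field.
Qed.

Lemma continuous_step' : continuous step'.
Proof.
move=> y; rewrite /step'.
have c1 : {for y, continuous (fun z : R => 1 - z)}.
  by apply: cvgB; [exact: cvg_cst|exact: cvg_id].
have cf k : {for y, continuous (fun z : R => flat k (1 - z))}.
  by apply: (@continuous_comp R R R (fun z : R => 1 - z) (flat k)) => //; exact: continuous_flat.
have cs : {for y, continuous flat_sum}.
  by apply: cvgD; [exact: continuous_flat|exact: cf].
apply: cvgM; first by apply: cvgD; apply: cvgM; solve [exact: continuous_flat|exact: cf].
apply: cvgV; first by rewrite sqrf_eq0 lt0r_neq0// flat_sum_gt0.
by apply: cvgM.
Qed.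

Lemma step'_bounded : exists2 M : R, 0 < M & forall y, `|step' y| <= M.
Proof.
have c : {within `[0, 1], continuous (fun y => `|step' y|)}.
  apply: continuous_subspaceT => y; apply: continuous_comp; first exact: continuous_step'.
  exact: norm_continuous.
have [z _ zmax] := EVT_max ler01 c.
exists (1 + `|step' z|); first by rewrite ltr_wpDr.
move=> y; have [y0|y0] := leP y 0; first by rewrite step'_le0// normr0 addr_ge0.
have [y1|y1] := leP 1 y; first by rewrite step'_ge1// normr0 addr_ge0.
rewrite (le_trans (zmax y _)) ?lerDr// in_itv/= !ltW//.
Qed.

End flat.

(** * A class of smooth functions on tuples *)

Section smooth_functions.
Context {R : realType} {N : nat}.
Notation V := (N.-tuple R).
Implicit Types (f g : V -> R) (x y : V).

Lemma shiftN0 x i : shiftN x i 0 = x.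
Proof. by apply: eq_from_tnth => j; rewrite tnth_mktuple; case: ifP; rewrite addr0. Qed.

(* Stable under partial derivatives, hence made of smooth functions. *)
Inductive smooth_term : (V -> R) -> Prop :=
| st_cst c : smooth_term (fun=> c)
| st_coord i : smooth_term (fun x => tnth x i)
| st_add f g : smooth_term f -> smooth_term g -> smooth_term (fun x => f x + g x)
| st_mul f g : smooth_term f -> smooth_term g -> smooth_term (fun x => f x * g x)
| st_flat k f : smooth_term f -> smooth_term (fun x => flat k (f x))
| st_powR a f : smooth_term f -> (forall x, 0 < f x) ->
    smooth_term (fun x => f x `^ a).

(** The class has no division, so the quotient becomes a product with the power -1 of the positive
    denominator. *)
Lemma st_step f : smooth_term f -> smooth_term (fun x => step (f x)).
Proof.
move=> sf; rewrite (_ : (fun x => _) = fun x => flat 0 (f x) *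
    (flat 0 (f x) + flat 0 (1 + (-1) * f x)) `^ (-1)).
  apply: st_mul; first exact: st_flat.
  apply: st_powR => [|x].
    apply: st_add; first exact: st_flat.
    apply: st_flat; apply: st_add; first exact: st_cst.
    by apply: st_mul => //; exact: st_cst.
  by rewrite mulN1r; exact: flat_sum_gt0.
apply/funext => x; rewrite mulN1r powR_inv1//.
by rewrite ltW//; exact: flat_sum_gt0.
Qed.

Lemma st_sum (I : Type) (s : seq I) (F : I -> V -> R) :
  (forall i, smooth_term (F i)) -> smooth_term (fun x => \sum_(i <- s) F i x).
Proof.
move=> sF; elim: s => [|i s IH].
  rewrite (_ : (fun x => _) = fun=> 0); first exact: st_cst.
  by apply/funext => x; rewrite big_nil.
rewrite (_ : (fun x => _) = fun x => F i x + \sum_(j <- s) F j x).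
  exact: st_add.
by apply/funext => x; rewrite big_cons.
Qed.

(** Records differentiability along with the value; [pderivN] alone returns a value even where the
    derivative does not exist. *)
Definition pderiv_at (i : 'I_N) f x (l : R) :=
  is_derive (0 : R) 1 (fun t : R => f (shiftN x i t)) l.

Lemma pderiv_at_add i f g x a b :
  pderiv_at i f x a -> pderiv_at i g x b -> pderiv_at i (fun x => f x + g x) x (a + b).
Proof. exact: is_deriveD. Qed.

Lemma pderiv_at_mul i f g x a b : pderiv_at i f x a -> pderiv_at i g x b ->
  pderiv_at i (fun x => f x * g x) x (f x * b + g x * a).
Proof. by move=> fa gb; have := is_deriveM fa gb; rewrite !shiftN0. Qed.

Lemma pderiv_at_comp i f (h : R -> R) x a b : is_derive (f x) 1 h b ->
  pderiv_at i f x a -> pderiv_at i (fun x => h (f x)) x (b * a).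
Proof.
move=> hb fa; apply: (@is_derive1_comp _ h (fun t => f (shiftN x i t))) => //.
by rewrite shiftN0.
Qed.

Lemma pderiv_at_coord i j x : pderiv_at i (fun x => tnth x j) x (i == j)%:R.
Proof.
rewrite /pderiv_at (_ : (fun t => _) = cst (tnth x j) + (fun t : R => (i == j)%:R * t)).
  have := is_deriveD (is_derive_cst (tnth x j) (0 : R) 1)
    (is_deriveZ (i == j)%:R (is_derive_id (0 : R) 1)).
  by rewrite add0r scaler1.
apply/funext => t; rewrite tnth_mktuple eq_sym.
rewrite -[RHS]/(tnth x j + (i == j)%:R * t).
by case: eqP; rewrite ?mul1r ?mul0r.
Qed.

Lemma pderiv_at_cst i c x : pderiv_at i (fun=> c) x 0.
Proof. exact: is_derive_cst. Qed.

Lemma pderivNE i f x l : pderiv_at i f x l -> pderivN i f x = l.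
Proof. by case=> _ fl; rewrite /pderivN derive1E. Qed.

(** This is why the class admits all [k] and all real exponents: differentiation sends [flat k] to
    [flat k.+1] and [flat k.+2], and the exponent a to a - 1. *)
Lemma st_pderiv i f : smooth_term f ->
  exists2 f', smooth_term f' & forall x, pderiv_at i f x (f' x).
Proof.
elim=> [c|j|{}f g sf [f' sf' df] sg [g' sg' dg]|{}f g sf [f' sf' df] sg [g' sg' dg]
  |k {}f sf [f' sf' df]|a {}f sf [f' sf' df] f0].
- by exists (fun=> 0); [exact: st_cst|move=> x; exact: pderiv_at_cst].
- exists (fun=> (i == j)%:R); [exact: st_cst|move=> x; exact: pderiv_at_coord].
- exists (fun x => f' x + g' x); [exact: st_add|move=> x; exact: pderiv_at_add].
- exists (fun x => f x * g' x + g x * f' x); last by move=> x; exact: pderiv_at_mul.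
  by apply: st_add; exact: st_mul.
- exists (fun x => (flat k.+2 (f x) + (- k%:R) * flat k.+1 (f x)) * f' x).
    apply: st_mul => //; apply: st_add; first exact: st_flat.
    by apply: st_mul; [exact: st_cst|exact: st_flat].
  move=> x; apply: (@pderiv_at_comp i f (flat k) x _ _ _ (df x)).
  by rewrite mulNr; exact: is_derive_flat.
- exists (fun x => (a * f x `^ (a - 1)) * f' x).
    by apply: st_mul => //; apply: st_mul; [exact: st_cst|exact: st_powR].
  move=> x; have d := @is_derive1_powR R a (f x) (f0 x).
  exact: (pderiv_at_comp d (df x)).
Qed.

(** The filter of Euclidean neighbourhoods of [x]: it turns [contN] into convergence along a filter,
    to which the limit rules for sums, products and compositions apply. *)
Let F x : set_system V := filter_from [set d : R | 0 < d] (fun d => [set y | normN (subN y x) < d]).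

Let F_filter x : Filter (F x).
Proof.
apply: filter_from_filter; first by exists 1 => /=.
move=> d e /= d0 e0; exists (Num.min d e); first by rewrite /= lt_min d0.
by move=> y /=; rewrite lt_min => /andP.
Qed.

Let contNP f : contN f <-> forall x, f y @[y --> F x] --> f x.
Proof.
split=> [cf x|cf x e e0]; have FF := F_filter x.
  apply/cvgrPdist_lt => e e0; have [d d0 fd] := cf x e e0.
  by exists d => // y /= /fd; rewrite distrC.
have /cvgrPdist_lt /(_ e e0)[d d0 fd] := cf x.
by exists d => // y /fd /=; rewrite distrC.
Qed.

Lemma st_cont f : smooth_term f -> contN f.
Proof.
move=> sf; apply/contNP => x; have FF := F_filter x.
elim: sf => [c|j|{}f g sf cf sg cg|{}f g sf cf sg cg|k {}f sf cf|a {}f sf cf f0].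
- exact: cvg_cst.
- apply/cvgrPdist_lt => e e0; exists e => // y /= ye.
  rewrite distrC (le_lt_trans _ ye)//.
  by have := abs_tnth_le_normN (subN y x) j; rewrite tnth_mktuple.
- exact: cvgD.
- exact: cvgM.
- by apply: continuous_cvg => //; exact: continuous_flat.
- apply: (@continuous_cvg _ _ _ _ _ f (fun y : R => y `^ a)) => //.
  apply: differentiable_continuous; apply/derivable1_diffP.
  by case: (is_derive1_powR a (f0 x)).
Qed.

Lemma st_smooth f : smooth_term f -> smoothN f.
Proof.
move=> sf s; have {sf} : smooth_term (iter_pderivN s f).
  elim: s => //= i s sg; have [g' sg' dg'] := st_pderiv i sg.
  rewrite (_ : pderivN i _ = g')//.
  by apply/funext => x; exact: pderivNE.
move=> sg; split; first exact: st_cont.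
move=> i x; have [g' _ /(_ x) d] := st_pderiv i sg.
by case: d.
Qed.

End smooth_functions.

(** * Smooth cutoffs of an interval *)

Section cutoff.
Context {R : realType}.
Variables (s t e : R).
Hypotheses (e0 : 0 < e) (ste : s + e <= t - e).

(* A smooth approximation of the indicator of [s, t], supported in [s, t]. *)
Definition cutoff (r : R) : R := step ((r - s) / e) + step ((t - r) / e) - 1.

(** A positive bump on [s, s + e] minus one on [t - e, t], each of mass 1, so that the integral
    against f approximates f(s) - f(t). *)
Definition cutoff' (r : R) : R := e^-1 * step' ((r - s) / e) - e^-1 * step' ((t - r) / e).

Let left_le (r : R) : r <= s -> (r - s) / e <= 0 /\ 1 <= (t - r) / e.
Proof.
move=> rs; split; [rewrite ler_pdivrMr//|rewrite ler_pdivlMr//]; move: rs ste e0; lra.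
Qed.

Let right_ge (r : R) : t <= r -> 1 <= (r - s) / e /\ (t - r) / e <= 0.
Proof.
by move=> rs; split; [rewrite ler_pdivlMr//|rewrite ler_pdivrMr//]; move: rs ste e0; lra.
Qed.

Lemma cutoff_le (r : R) : r <= s -> cutoff r = 0.
Proof. by move=> /left_le[r1 r2]; rewrite /cutoff step_le0// step_ge1// add0r subrr. Qed.

Lemma cutoff_ge (r : R) : t <= r -> cutoff r = 0.
Proof. by move=> /right_ge[r1 r2]; rewrite /cutoff step_ge1// step_le0// addr0 subrr. Qed.

Lemma cutoff'_le (r : R) : r <= s -> cutoff' r = 0.
Proof. by move=> /left_le[r1 r2]; rewrite /cutoff' step'_le0// step'_ge1// subrr. Qed.

Lemma cutoff'_ge (r : R) : t <= r -> cutoff' r = 0.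
Proof. by move=> /right_ge[r1 r2]; rewrite /cutoff' step'_ge1// step'_le0// subrr. Qed.

Lemma cutoff_abs (r : R) : `|cutoff r| <= 1.
Proof.
rewrite /cutoff ler_norml.
have := step_ge0 ((r - s) / e); have := step_le1 ((r - s) / e).
have := step_ge0 ((t - r) / e); have := step_le1 ((t - r) / e).
move: (step _) (step _) => A B A1 A0 B1 B0.
by apply/andP; split; lra.
Qed.

Lemma is_derive_step_affine (k c : R) (r : R) :
  is_derive r 1 (fun r => step ((k * r + c) / e)) (e^-1 * (k * step' ((k * r + c) / e))).
Proof.
have d : is_derive r 1 (fun r : R => (k * r + c) / e) (k / e).
  rewrite (_ : (fun r : R => _) = (fun r => (k / e) * r) + cst (c / e)).
    have := is_deriveD (is_deriveZ (k / e) (is_derive_id r 1)) (is_derive_cst (c / e) r 1).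
    by rewrite addr0 scaler1.
  by apply/funext => y; rewrite -[RHS]/((k / e) * y + c / e); field; exact: lt0r_neq0.
apply: (is_derive_eq (@is_derive1_comp _ step (fun r : R => (k * r + c) / e) r _ _ (is_derive_step _) d)).
by field; exact: lt0r_neq0.
Qed.

Lemma is_derive_cutoff (r : R) : is_derive r 1 cutoff (cutoff' r).
Proof.
rewrite (_ : cutoff = (fun r : R^o => step ((1 * r + - s) / e)) +
    (fun r : R^o => step ((- 1 * r + t) / e)) + cst (- 1 : R)).
  have d1 := is_derive_step_affine 1 (- s) r.
  have d2 := is_derive_step_affine (- 1) t r.
  have d := is_deriveD (is_deriveD d1 d2) (is_derive_cst (- 1 : R) r 1).
  apply: (is_derive_eq d).
  by rewrite /cutoff' mul1r !mulN1r !mul1r mulrN addr0 (addrC (- r)).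
apply/funext => y; rewrite -[RHS]/(step ((1 * y + - s) / e) + step ((- 1 * y + t) / e) - 1).
by rewrite mul1r mulN1r (addrC (- y)).
Qed.

End cutoff.

(** * Radial test functions *)

Section radial_test_function.
Context {R : realType} {N : nat} (N_gt0 : (0 < N)%N).
Notation V := (N.-tuple R).
Variables (s t e : R).
Hypotheses (s0 : 0 < s) (e0 : 0 < e) (ste : s + e <= t - e).
Implicit Types x : V.

Definition radial_test x : R := normN x `^ (1 - N%:R) * cutoff s t e (normNN x).

Lemma radial_test_eq0 x : normNN x <= s \/ t <= normNN x -> radial_test x = 0.
Proof.
by case=> h; rewrite /radial_test; [rewrite cutoff_le|rewrite cutoff_ge]; rewrite ?mulr0.
Qed.

Let a : R := s `^ N%:R^-1.
Let a0 : 0 < a. Proof. exact: powR_gt0. Qed.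

Let q x : R := \sum_(j < N) tnth x j ^+ 2.

(* A smooth positive function which equals |x|^2 where |x| >= a. *)
Let m x : R := q x + flat 0 (a ^+ 2 - q x).

Let qE x : q x = normN x ^+ 2. Proof. by rewrite normN_sq. Qed.

Let m_gt0 x : 0 < m x.
Proof.
rewrite /m qE; have [->|x0] := eqVneq (normN x) 0.
  by rewrite expr0n/= add0r subr0 flat_gt0// exprn_gt0.
by rewrite ltr_wpDr ?flat_ge0// exprn_gt0// lt_def x0 normN_ge0.
Qed.

Let m_ge x : a <= normN x -> m x = normN x ^+ 2.
Proof.
move=> ax; rewrite /m flat_le0 ?addr0 ?qE// subr_le0 lerXn2r// nnegrE ?normN_ge0//.
exact: ltW.
Qed.

(** Since exp(-1/z) <= z, the positive correction never lifts [m] above a^2; the cutoff thus still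
    vanishes after |x|^2 is replaced by [m]. *)
Let m_le x : normN x <= a -> m x <= a ^+ 2.
Proof.
move=> xa; rewrite /m qE -lerBrDl flat0_le_id// subr_ge0 lerXn2r// nnegrE ?normN_ge0//.
exact: ltW.
Qed.

Let sqr_powR (y b : R) : 0 <= y -> (y ^+ 2) `^ (b / 2) = y `^ b.
Proof. by move=> y0; rewrite -powR_mulrn// -powRrM mulrC divfK. Qed.

Let G (y : R) : R := y `^ ((1 - N%:R) / 2) * cutoff s t e (y `^ (N%:R / 2)).

Let normNN_a x : normN x <= a -> normNN x <= s.
Proof. by rewrite normNN_le// ltW. Qed.

Let m_root_le x : normN x <= a -> m x `^ (N%:R / 2) <= s.
Proof.
move=> xa; rewrite -[leRHS](powR_root_expn N_gt0 (ltW s0)) -/a.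
rewrite -powR_mulrn ?(ltW a0)// -(sqr_powR _ (ltW a0)).
apply: ge0_ler_powR; rewrite ?nnegrE ?sqr_ge0 ?(ltW (m_gt0 x)) ?divr_ge0//.
exact: m_le.
Qed.

(** For |x| > a the two agree because [m] is |x|^2 there; for |x| <= a both vanish, the cutoff being
    evaluated at arguments at most s. The right-hand side is smooth across the origin. *)
Let testE : radial_test = G \o m.
Proof.
apply/funext => x; rewrite /= /G; have [xa|ax] := leP (normN x) a.
  rewrite radial_test_eq0; last by left; exact: normNN_a.
  by rewrite cutoff_le ?mulr0// m_root_le.
rewrite m_ge ?(ltW ax)// !sqr_powR ?normN_ge0//.
by rewrite powR_mulrn ?normN_ge0.
Qed.

Lemma testfun_radial_test : testfunN radial_test.
Proof.
split.
  apply: st_smooth; rewrite testE /G/=.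
  have st_opp f : smooth_term f -> smooth_term (fun x => - f x).
    move=> sf; rewrite (_ : (fun x => _) = fun x => (- 1) * f x).
      by apply: st_mul => //; exact: st_cst.
    by apply/funext => x; rewrite mulN1r.
  have st_q : smooth_term q.
    by apply: st_sum => j; apply: st_mul; exact: st_coord.
  have st_m : smooth_term m.
    apply: st_add => //; apply: st_flat; apply: st_add; first exact: st_cst.
    exact: st_opp.
  have st_mN : smooth_term (fun x => m x `^ (N%:R / 2)) by exact: st_powR.
  apply: st_mul; first exact: st_powR.
  apply: st_add; last exact: st_cst.
  apply: st_add; apply: st_step; apply: st_mul; try exact: st_cst.
    by apply: st_add => //; exact: st_cst.
  by apply: st_add; [exact: st_cst|exact: st_opp].
have st : s < t by move: ste e0; lra.
exists a, (t `^ N%:R^-1); split => //.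
  by apply: gt0_ltr_powR => //; rewrite ?nnegrE ?invr_gt0 ?ltr0n ?(ltW s0)// ltW// (lt_trans s0).
move=> x [xa|tx]; apply: radial_test_eq0; first by left; apply/normNN_a/ltW.
right; rewrite leNgt; apply/negP => /ltW.
by rewrite normNN_le ?(ltW (lt_trans s0 st))// leNgt tx.
Qed.

Let G' (y : R) : R :=
  y `^ ((1 - N%:R) / 2) * (cutoff' s t e (y `^ (N%:R / 2)) * (N%:R / 2 * y `^ (N%:R / 2 - 1))) +
  cutoff s t e (y `^ (N%:R / 2)) * ((1 - N%:R) / 2 * y `^ ((1 - N%:R) / 2 - 1)).

Let is_derive_G (y : R) : 0 < y -> is_derive y 1 G (G' y).
Proof.
move=> y0.
have d1 := @is_derive1_powR R ((1 - N%:R) / 2) y y0.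
have d2 := @is_derive1_powR R (N%:R / 2) y y0.
exact: (is_deriveM d1 (is_derive1_comp (is_derive_cutoff s t e0 _) d2)).
Qed.

Let pderiv_m i x : pderiv_at i m x (2 * tnth x i * (1 - flat 2 (a ^+ 2 - q x))).
Proof.
have dq : pderiv_at i q x (2 * tnth x i).
  rewrite /pderiv_at (_ : (fun u => _) = \sum_(j < N) (fun u => tnth (shiftN x i u) j ^+ 2)).
    have d j : pderiv_at i (fun x => tnth x j ^+ 2) x
        (tnth x j * (i == j)%:R + tnth x j * (i == j)%:R).
      by apply: (@pderiv_at_mul _ _ i (fun x => tnth x j) (fun x => tnth x j));
        exact: pderiv_at_coord.
    apply: (is_derive_eq (is_derive_sum d)).
    rewrite (bigD1 i)//= eqxx mulr1 big1 ?addr0; first by ring.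
    by move=> j /negPf ji; rewrite eq_sym ji mulr0 addr0.
  by apply/funext => u; rewrite fct_sumE.
have da : is_derive (q x) 1 (fun y : R => a ^+ 2 - y) (- 1).
  have := is_deriveB (is_derive_cst (a ^+ 2) (q x) 1) (is_derive_id (q x) 1).
  by rewrite sub0r.
have df := pderiv_at_comp (is_derive_flat 0 _) (pderiv_at_comp da dq).
have := pderiv_at_add dq df; rewrite mul0r subr0.
by congr pderiv_at; ring.
Qed.

(** The left-hand side is the divergence of phi x/|x|. As x/|x|^N has divergence zero off the
    origin, only the derivative of the cutoff survives, and N is |x|^(1-N) times the derivative of
    r^N at r = |x|. *)
Lemma radial_test_divergence x :
  \sum_(i < N) tnth x i / normN x * pderivN i radial_test x +
    (N%:R - 1) * radial_test x / normN x = N%:R * cutoff' s t e (normNN x).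
Proof.
have -> : \sum_(i < N) tnth x i / normN x * pderivN i radial_test x =
    G' (m x) * 2 * (1 - flat 2 (a ^+ 2 - q x)) * (q x / normN x).
  rewrite /q mulr_suml mulr_sumr; apply: eq_bigr => i _.
  rewrite testE (pderivNE (pderiv_at_comp (is_derive_G (m_gt0 x)) (pderiv_m i x))).
  by rewrite expr2; ring.
have [xa|ax] := leP (normN x) a.
  rewrite radial_test_eq0; last by left; exact: normNN_a.
  rewrite (cutoff'_le e0 ste (normNN_a xa)).
  by rewrite /G' cutoff_le ?m_root_le// cutoff'_le ?m_root_le//; ring.
rewrite flat_le0; last by rewrite subr_le0 qE lerXn2r ?nnegrE ?normN_ge0 ?(ltW a0) ?(ltW ax).
have x0 : 0 < normN x by exact: lt_trans ax.
rewrite /G' m_ge ?(ltW ax)// !sqr_powR ?normN_ge0//.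
rewrite powR_mulrn ?normN_ge0// -/(normNN x) qE /radial_test.
have p1 : (normN x ^+ 2) `^ ((1 - N%:R) / 2 - 1) = normN x `^ (1 - N%:R) / normN x ^+ 2.
  rewrite powRD; last by rewrite sqrf_eq0 lt0r_neq0 ?implybT.
  by rewrite sqr_powR ?normN_ge0// powR_inv1// sqr_ge0.
have p2 : (normN x ^+ 2) `^ (N%:R / 2 - 1) = normNN x / normN x ^+ 2.
  rewrite powRD; last by rewrite sqrf_eq0 lt0r_neq0 ?implybT.
  by rewrite sqr_powR ?normN_ge0// powR_inv1 ?sqr_ge0// powR_mulrn ?normN_ge0.
have p3 : normN x `^ (1 - N%:R) * normNN x = normN x.
  rewrite /normNN -powR_mulrn ?normN_ge0// -powRD; last by rewrite lt0r_neq0 ?implybT.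
  by rewrite subrK powRr1// normN_ge0.
rewrite p1 p2; move: p3.
set A := normN x `^ _; set B := normNN x; set r := normN x => AB.
(* The relation |x|^(1-N) |x|^N = |x| is inserted as a factor 1, so that what remains is an identity
   in independent A, B and r, within reach of [field]. *)
have c'E : cutoff' s t e B = cutoff' s t e B * (A * B / r).
  by rewrite AB divff ?mulr1 ?lt0r_neq0.
rewrite [in RHS]c'E.
by field; exact: lt0r_neq0.
Qed.

End radial_test_function.

(** * One-sided mollification at Lebesgue points *)

Section mollification.
Context {R : realType}.
Notation leb := (@lebesgue_measure R).

(** The sign k selects the side: k = 1 puts the kernel on [s, s + e], k = -1 on [s - e, s]. *)
Definition kernel_at (k s e r : R) : R := e^-1 * step' (k * (r - s) / e).

Lemma is_derive_kernel_at (k s e r : R) : 0 < e -> k ^+ 2 = 1 ->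
  is_derive r 1 (fun r => k * step (k * (r - s) / e)) (kernel_at k s e r).
Proof.
move=> e0 k1; have d := is_deriveZ k (is_derive_step_affine e0 k (- (k * s)) r).
have E : forall y, k * (y - s) / e = (k * y + - (k * s)) / e by move=> y; rewrite mulrBr.
rewrite (_ : (fun r => _) = k \*: (fun r : R => step ((k * r + - (k * s)) / e))).
  apply: (is_derive_eq d); rewrite /kernel_at E /GRing.scale/=.
  by rewrite mulrCA (mulrA k k) -expr2 k1 mul1r.
by apply/funext => y; rewrite E.
Qed.

Lemma continuous_kernel_at (k s e : R) : continuous (kernel_at k s e).
Proof.
move=> r; apply: cvgM; first exact: cvg_cst.
apply: (@continuous_comp R R R (fun r => k * (r - s) / e) (@step' R)); last exact: continuous_step'.
apply: cvgM; last exact: cvg_cst.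
apply: cvgM; first exact: cvg_cst.
by apply: cvgB; [exact: cvg_id|exact: cvg_cst].
Qed.

Lemma kernel_at_eq0 (k s e r : R) : 0 < e -> k ^+ 2 = 1 -> e <= `|r - s| -> kernel_at k s e r = 0.
Proof.
move=> e0 k1 re; rewrite /kernel_at.
have kn : `|k| = 1.
  by apply/eqP; rewrite -sqrp_eq1// -normrX k1 normr1.
have : 1 <= `|k * (r - s) / e|.
  by rewrite !normrM kn mul1r normfV (gtr0_norm e0) ler_pdivlMr// mul1r.
rewrite ler_normr => /orP[h|h]; first by rewrite step'_ge1// mulr0.
rewrite step'_le0 ?mulr0// -oppr_ge0 (le_trans _ h)//.
Qed.

Lemma integral_kernel_at (k s e : R) : 0 < e -> k ^+ 2 = 1 ->
  (\int[leb]_r (kernel_at k s e r)%:E = 1)%E.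
Proof.
move=> e0 k1.
transitivity (\int[leb]_(r in `[(s - e)%R, (s + e)%R]) (kernel_at k s e r)%:E)%E.
  rewrite [in RHS]integral_mkcond; apply: eq_integral => r _.
  rewrite patchE; case: ifPn => //; rewrite notin_setE/= in_itv/= => /negP h.
  rewrite kernel_at_eq0//; move: h; apply: contraNle.
  by rewrite ltr_norml => /andP[h1 h2]; apply/andP; split; lra.
rewrite (@continuous_FTC2 _ _ (fun r => k * step (k * (r - s) / e))).
- rewrite (addrC s) addrK addrAC subrr add0r mulrN mulNr mulfK ?lt0r_neq0//.
  rewrite -EFinD.
  move: k1 => /eqP; rewrite sqrf_eq1 => /orP[] /eqP ->.
    by rewrite (@step_ge1 R 1)// (@step_le0 R (- 1)) ?lerN10// mulr0 subr0 mul1r.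
  by rewrite opprK (@step_ge1 R 1)// (@step_le0 R (- 1)) ?lerN10// mulr0 add0r mulr1 opprK.
- lra.
- by apply: continuous_subspaceT; exact: continuous_kernel_at.
- have c : continuous (fun r => k * step (k * (r - s) / e)).
    by apply: continuous_is_derive => r; exact: is_derive_kernel_at.
  split.
  + by move=> r _; case: (is_derive_kernel_at s r e0 k1).
  + by apply: cvg_at_right_filter; exact: c.
  + by apply: cvg_at_left_filter; exact: c.
- move=> r _; rewrite derive1E; by case: (is_derive_kernel_at s r e0 k1).
Qed.

Lemma kernel_at_le (M k s e r : R) : (forall y, `|step' y| <= M) -> 0 < e ->
  `|kernel_at k s e r| <= M / e.
Proof.
by move=> hM e0; rewrite normrM normfV (gtr0_norm e0) mulrC ler_wpM2r// invr_ge0 ltW.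
Qed.

Lemma integrable_kernel_at_mul (f : R -> R) (k s e : R) : 0 < e ->
  leb.-integrable setT (EFin \o f) ->
  leb.-integrable setT (fun r => (kernel_at k s e r * f r)%:E).
Proof.
move=> e0 intf; have [M M0 hM] := @step'_bounded R.
have mf : measurable_fun setT f by apply/measurable_EFinP; exact: measurable_int intf.
have ig : leb.-integrable setT (fun r => (M / e)%:E * (EFin \o f) r)%E by exact: integrableZl.
apply: le_integrable ig => //.
- apply/measurable_EFinP; apply: measurable_funM => //.
  by apply: continuous_measurable_fun; exact: continuous_kernel_at.
- move=> r _; rewrite -EFinM !abse_EFin lee_fin [leLHS]normrM [leRHS]normrM ler_wpM2r//.
  by rewrite (ger0_norm (divr_ge0 (ltW M0) (ltW e0))) kernel_at_le.
Qed.

(** The kernel has mass 1, so the error is the integral of kernel times f - f(s). The kernel being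
    at most M/e and supported near s, the mean oscillation of f over a symmetric ball controls it,
    although the kernel is one-sided. *)
Lemma mollify_lebesgue_pt (f : R -> R) (k s : R) : k ^+ 2 = 1 ->
  leb.-integrable setT (EFin \o f) -> lebesgue_pt f s ->
  forall eta : R, 0 < eta -> exists2 d : R, 0 < d & forall e : R, 0 < e < d ->
    (`| \int[leb]_r (kernel_at k s e r * f r)%:E - (f s)%:E | <= eta%:E)%E.
Proof.
move=> k1 intf fs eta eta0; have [M M0 hM] := @step'_bounded R.
(* The ball of radius 2e has measure 4e, and 4e times the bound M/e on the kernel is 4M. *)
have eta1 : 0 < eta / (4 * M) by rewrite divr_gt0// mulr_gt0.
have [d d0 hd] : exists2 d : R, 0 < d & forall r, 0 < r < d -> (davg f s r <= (eta / (4 * M))%:E)%E.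
  have : nbhs (0 : \bar R) [set x | x < (eta / (4 * M))%:E]%E by exact: (lt_nbhsl eta1).
  move=> /fs[d /= d0 hd]; exists d => // r /andP[r0 rd]; apply/ltW/hd => //=.
  by rewrite sub0r normrN gtr0_norm.
exists (d / 2); first by rewrite divr_gt0.
move=> e /andP[e0 ed].
have mf : measurable_fun setT f by apply/measurable_EFinP; exact: measurable_int intf.
have mk : measurable_fun setT (kernel_at k s e).
  by apply: continuous_measurable_fun; exact: continuous_kernel_at.
have intk : leb.-integrable setT (EFin \o kernel_at k s e).
  pose I := `[(s - e)%R, (s + e)%R]%classic.
  have intI : leb.-integrable setT (EFin \o (\1_I : R -> R)) by exact: integrable_indic_itv.
  rewrite (_ : _ \o _ = fun r => (kernel_at k s e r * \1_I r)%:E).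
    exact: integrable_kernel_at_mul.
  apply/funext => r /=; rewrite indicE; have [_|] := boolP (r \in I); first by rewrite mulr1.
  rewrite notin_setE /I/= in_itv/= => /negP h; rewrite kernel_at_eq0 ?mul0r//.
  move: h; apply: contraNle.
  by rewrite ltr_norml => /andP[h1 h2]; apply/andP; split; lra.
have -> : (f s)%:E = (\int[leb]_r ((f s)%:E * (EFin \o kernel_at k s e) r))%E.
  by rewrite integralZl// integral_kernel_at// mule1.
rewrite -integralB//; [|exact: integrable_kernel_at_mul|exact: integrableZl].
have m1 : measurable_fun setT (fun r => kernel_at k s e r * (f r - f s)).
  by apply: measurable_funM => //; exact: measurable_funB.
rewrite (_ : (fun _ => _) = fun r => (kernel_at k s e r * (f r - f s))%:E); last first.
  by apply/funext => r; rewrite mulrBr EFinB (mulrC _ (f s)) EFinM.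
apply: (le_trans (le_abse_integral _ _ _)) => //; first exact/measurable_EFinP.
have e2 : 0 < 2 * e by rewrite mulr_gt0.
apply: (@le_trans _ _ (\int[leb]_(r in ball s (2 * e)) ((M / e)%:E * `|(f r - f s)%:E|))%E).
  rewrite [leRHS]integral_mkcond; apply: ge0_le_integral => //.
  - by apply: measurableT_comp => //; exact/measurable_EFinP.
  - apply/(measurable_restrictT _ _).1; first exact: measurable_ball.
    apply: measurable_funeM; apply: measurableT_comp => //; apply/measurable_EFinP.
    by apply: measurable_funTS; exact: measurable_funB.
  - move=> r _; rewrite patchE; case: ifPn.
      move=> _; rewrite -EFinM lee_fin normrM ler_wpM2r//.
      exact: kernel_at_le.
    rewrite notin_setE /ball/= => /negP; rewrite -leNgt distrC => h.
    have k0 : kernel_at k s e r = 0.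
      by apply: kernel_at_eq0 => //; apply: le_trans h; lra.
    by rewrite k0 mul0r normr0.
rewrite ge0_integralZl//; first last.
- by rewrite lee_fin divr_ge0// ltW.
- apply: measurableT_comp => //; apply/measurable_EFinP.
  by apply: measurable_funTS; exact: measurable_funB.
- exact: measurable_ball.
have /hd : 0 < 2 * e < d by rewrite e2/=; lra.
rewrite /davg /iavg lebesgue_measure_ball ?(ltW e2)// => h.
have M4 : 0 <= 4 * M by rewrite mulr_ge0// ltW.
have := @lee_wpmul2l R (4 * M)%:E _ _ _ h; rewrite lee_fin => /(_ M4).
rewrite muleA inver mulrn_eq0/= (gt_eqF e2) -!EFinM.
rewrite (_ : 4 * M * (eta / (4 * M)) = eta); last by field; exact: lt0r_neq0.
rewrite (_ : 4 * M * (2 * e *+ 2)^-1 = M / e)//.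
by rewrite -mulr_natr; field; exact: lt0r_neq0.
Qed.

Lemma cutoff'_kernel_at (s t e r : R) :
  cutoff' s t e r = kernel_at 1 s e r - kernel_at (- 1) t e r.
Proof. by rewrite /cutoff' /kernel_at mul1r mulN1r opprB. Qed.

Lemma integrable_cutoff'_mul (f : R -> R) (s t e : R) : 0 < e ->
  leb.-integrable setT (EFin \o f) ->
  leb.-integrable setT (fun r => (cutoff' s t e r * f r)%:E).
Proof.
move=> e0 intf; rewrite (_ : (fun r => _) = (fun r => (kernel_at 1 s e r * f r)%:E) \-
    (fun r => (kernel_at (- 1) t e r * f r)%:E))%E.
  by apply: integrableB => //; exact: integrable_kernel_at_mul.
by apply/funext => r; rewrite cutoff'_kernel_at mulrBl EFinB.
Qed.

Lemma abse_subB_le (x y : \bar R) (a b eta : R) :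
  x \is a fin_num -> y \is a fin_num ->
  (`|x - a%:E| <= (eta / 2)%:E)%E -> (`|y - b%:E| <= (eta / 2)%:E)%E ->
  (`|x - y - (a - b)%:E| <= eta%:E)%E.
Proof.
case: x y => [x||] [y||]// _ _; rewrite -!EFinB !abse_EFin !lee_fin => xa yb.
have -> : x - y - (a - b) = (x - a) - (y - b) by ring.
by rewrite (le_trans (ler_normB _ _))//; lra.
Qed.

Lemma integral_cutoff' (f : R -> R) (s t : R) : s < t ->
  leb.-integrable setT (EFin \o f) -> lebesgue_pt f s -> lebesgue_pt f t ->
  forall eta : R, 0 < eta -> exists e : R, [/\ 0 < e, s + e <= t - e &
    (`| \int[leb]_r (cutoff' s t e r * f r)%:E - (f s - f t)%:E | <= eta%:E)%E].
Proof.
move=> st intf fs ft eta eta0.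
have k1 : (1 : R) ^+ 2 = 1 by rewrite expr1n.
have k2 : (- 1 : R) ^+ 2 = 1 by rewrite sqrrN expr1n.
have eta2 : 0 < eta / 2 by rewrite divr_gt0.
have [d1 d10 h1] := mollify_lebesgue_pt k1 intf fs eta2.
have [d2 d20 h2] := mollify_lebesgue_pt k2 intf ft eta2.
(* Halving the minimum gives e < d1 and e < d2 strictly, and 2e <= t - s, so the two bumps do not
   overlap. *)
pose e := Num.min (Num.min d1 d2) (t - s) / 2.
have m0 : 0 < Num.min (Num.min d1 d2) (t - s) by rewrite !lt_min d10 d20 subr_gt0.
have e0 : 0 < e by rewrite divr_gt0.
have em : e < Num.min (Num.min d1 d2) (t - s) by rewrite /e; lra.
have := em; rewrite !lt_min => /andP[/andP[ed1 ed2] _].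
exists e; split => //.
  have : e <= (t - s) / 2 by rewrite ler_pM2r// ge_min lexx orbT.
  lra.
have i1 := integrable_kernel_at_mul 1 s e0 intf.
have i2 := integrable_kernel_at_mul (- 1) t e0 intf.
rewrite (_ : (fun r => _) = fun r =>
  ((kernel_at 1 s e r * f r)%:E - (kernel_at (- 1) t e r * f r)%:E)%E); last first.
  by apply/funext => r; rewrite cutoff'_kernel_at -EFinB mulrBl.
rewrite integralB//.
have h1e := h1 e; rewrite e0 ed1 in h1e.
have h2e := h2 e; rewrite e0 ed2 in h2e.
exact: abse_subB_le (integrable_fin_num measurableT i1)
  (integrable_fin_num measurableT i2) (h1e isT) (h2e isT).
Qed.

End mollification.

(** * The profile of a radial function and its increments *)

Section radial_profile.
Context {R : realType} {N : nat} (N_gt0 : (0 < N)%N).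
Notation leb := (@lebesgue_measure R).
Notation V := (N.-tuple R).
Notation K := (@kappa R N).

Let e1 : V := [tuple (i == Ordinal N_gt0)%:R | i < N].

Let normN_e1 : normN e1 = 1.
Proof.
rewrite /normN (bigD1 (Ordinal N_gt0))//= big1 => [|j jN].
  by rewrite tnth_mktuple eqxx expr1n addr0 sqrtr1.
by rewrite tnth_mktuple (negPf jN) expr0n.
Qed.

Definition profile (u : V -> R) (s : R) : R := u (scaleN (s `^ N%:R^-1) e1).

Lemma profileE (u : V -> R) x : radialN u -> u x = profile u (normNN x).
Proof.
move=> ru; apply: ru; rewrite normN_scale ?powR_ge0// normN_e1 mulr1.
by rewrite powR_expn_root// normN_ge0.
Qed.

Lemma measurable_profile (u : V -> R) :
  measurable_fun setT u -> measurable_fun setT (profile u).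
Proof.
move=> mu; apply: (measurableT_comp mu); apply/measurable_fun_tnthP => i.
rewrite (_ : _ \o _ = fun s : R => s `^ N%:R^-1 * tnth e1 i).
  by apply: measurable_funM => //; exact: measurable_powR.
by apply/funext => s /=; rewrite tnth_mktuple.
Qed.

Variable u : V -> R.
Hypotheses (ru : radialN u) (lu : L1locN u).
Notation W := (profile u).

(** The profile is integrable only away from 0 and infinity, while the mollification takes functions
    integrable on the line; hence truncation to windows exhausting the half-line. *)
Definition window (n : nat) : set R := `[n.+1%:R^-1, n.+1%:R].

Lemma integrable_profile_window n : leb.-integrable setT (EFin \o (W \_ (window n))).
Proof.
have [mu fin] := lu.
have mW := measurable_profile mu.
have mw : measurable (window n) by exact: measurable_itv.
have n0 : (0 : R) < n.+1%:R^-1 by rewrite invr_gt0.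
have -> : EFin \o (W \_ (window n)) = (EFin \o W) \_ (window n).
  by apply/funext => r; rewrite /= !patchE; case: ifP.
apply/integrable_restrict => //; rewrite setTI.
apply/integrableP; split; first by apply: measurable_funTS; exact/measurable_EFinP.
have Kfin : (K%:E * \int[leb]_(r in window n) `|(EFin \o W) r| < +oo)%E.
  rewrite -ge0_integral_normNN//.
  - pose a : R := n.+1%:R^-1 `^ N%:R^-1.
    (* The extra 1 keeps a < b, as [L1locN] demands: for n = 0 the window is the single point 1. *)
    pose b : R := (n.+1%:R + 1) `^ N%:R^-1.
    have ab : a < b.
      apply: gt0_ltr_powR; rewrite ?invr_gt0 ?ltr0n// ?nnegrE ?invr_ge0//.
      apply: (@le_lt_trans _ _ n.+1%:R); last by rewrite ltrDl.
      by rewrite (le_trans (_ : _ <= 1)) ?invf_le1 ?ler1n.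
    have a0 : 0 < a by exact: powR_gt0.
    apply: le_lt_trans (fin a b a0 ab).
    under eq_integral do rewrite /= -profileE//.
    apply: ge0_subset_integral => //.
    + exact: measurable_preimage_normNN.
    + rewrite (_ : [set x | _] = @normN R N @^-1` `[a, b]).
        by rewrite -[X in measurable X]setTI; exact: measurable_normN.
      by apply/seteqP; split=> x /=; rewrite in_itv.
    + by apply: measurable_funTS; apply/measurable_EFinP; exact: measurableT_comp.
    + move=> x; rewrite /window/= in_itv/= => /andP[nx xn].
      have -> : normN x = normNN x `^ N%:R^-1 by rewrite powR_expn_root// normN_ge0.
      have N0 : (0 : R) <= N%:R^-1 by rewrite invr_ge0.
      apply/andP; split; apply: ge0_ler_powR => //; rewrite ?nnegrE ?normNN_ge0 ?invr_ge0//.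
      by rewrite (le_trans xn)// lerDl.
  - by move=> r; rewrite /window/= !in_itv/= andbT => /andP[/(le_trans _) h _]; apply: h; exact: ltW.
  - by apply: measurableT_comp => //; apply: measurable_funTS; exact/measurable_EFinP.
move: Kfin; rewrite muleC.
have := @integral_ge0 _ _ _ leb (window n) (fun r => `|(EFin \o W) r|%E) (fun r _ => abse_ge0 _).
case: (\int[leb]_(r in _) _)%E => [r _ _|_|//]; first exact: ltry.
by rewrite gt0_mulye// lte_fin kappa_gt0.
Qed.

(** Imposed for all windows at once, so that any two good points can be compared inside a common
    window. *)
Definition good (s : R) := forall n, lebesgue_pt (W \_ (window n)) s.

Lemma ae_good : {ae leb, forall s, good s}.
Proof.
apply: ae_foralln => n; apply: lebesgue_differentiation; split.
- by apply/measurable_EFinP; exact: measurable_int (integrable_profile_window n).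
- exact: openT.
move=> D _ cD; have /integrableP[mf] := integrable_profile_window n.
apply: le_lt_trans; apply: ge0_subset_integral => //.
  exact: compact_measurable.
have /measurable_EFinP mf' := mf.
by apply/measurable_EFinP; apply: (measurableT_comp _ mf').
Qed.

Variable g : V -> R.
Hypotheses (mg : measurable_fun setT g) (dug : radial_derivN u g).

Definition weighted_mass (D : set R) : \bar R :=
  (\int[@lebN R N]_(x in normNN @^-1` D) (`|g x| * normN x `^ (1 - N%:R))%:E)%E.

(** No limit of test functions is taken: each error eta gets its own cutoff. The pairing with [g] is
    bounded independently of the cutoff, whose modulus is at most 1 and which vanishes off [s, t];
    only the pairing with [u] has to approximate. *)
Lemma profile_increment (s t : R) : 0 < s -> s < t -> good s -> good t ->
  ((K * N%:R * `|W s - W t|)%:E <= weighted_mass `[s, t])%E.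
Proof.
move=> s0 st gs gt.
have [n [ns tn]] : exists n, n.+1%:R^-1 < s /\ t < n.+1%:R.
  (* This makes n + 1 exceed both 1/s and t, so [s, t] lies inside the window. *)
  exists (Num.truncn (s^-1 + t)); have := truncnS_gt (s^-1 + t).
  set m := _.+1%:R => h; have si : 0 < s^-1 by rewrite invr_gt0.
  have t0 := lt_trans s0 st.
  by split; [rewrite invf_plt ?posrE//|]; lra.
pose f := W \_ (window n).
have intf : leb.-integrable setT (EFin \o f) := integrable_profile_window n.
have fE r : s <= r -> r <= t -> f r = W r.
  move=> sr rt; rewrite /f patchE ifT// inE /window/= in_itv/=.
  by rewrite (le_trans (ltW ns) sr) (le_trans rt (ltW tn)).
have -> : W s - W t = f s - f t by rewrite !fE// ltW.
have KN0 : 0 < K * N%:R by rewrite mulr_gt0 ?kappa_gt0// ltr0n.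
apply/lee_addgt0Pr => eta eta0.
have eta1 : 0 < eta / (K * N%:R) by rewrite divr_gt0.
have [e [e0 ste he]] := integral_cutoff' st intf (gs n) (gt n) eta1.
have int_cf := integrable_cutoff'_mul s t e0 intf.
have := dug (testfun_radial_test N_gt0 s0 e0 ste).
set lhs := (\int[_]_x _)%E; set rhs := (\int[_]_x _)%E => lr.
have lhs_le : (`|lhs| <= weighted_mass `[s, t])%E.
    have mD : measurable (@normNN R N @^-1` `[s, t]) by exact: measurable_preimage_normNN.
    have mw : measurable_fun setT (fun x : V => normN x `^ (1 - N%:R)).
      by apply: (@measurableT_comp _ _ _ _ _ _ (@powR R ^~ _)) => //; exact: measurable_normN.
    have mphi : measurable_fun setT (@radial_test R N s t e).
      apply: measurable_funM => //; apply: measurableT_comp measurable_normNN.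
      apply: continuous_measurable_fun; apply: continuous_is_derive => r.
      exact: is_derive_cutoff.
    have mgw : measurable_fun setT (fun x : V => `|g x| * normN x `^ (1 - N%:R)).
      by apply: measurable_funM => //; exact: measurableT_comp.
    apply: (le_trans (le_abse_integral _ _ _)) => //.
      by apply/measurable_EFinP; exact: measurable_funM.
    rewrite /weighted_mass [leRHS]integral_mkcond; apply: ge0_le_integral => //.
    - by apply: measurableT_comp => //; apply/measurable_EFinP; exact: measurable_funM.
    - by apply/(measurable_restrictT _ _).1 => //; apply: measurable_funTS; exact/measurable_EFinP.
    move=> x _; rewrite patchE; case: ifPn.
      move=> _; rewrite lee_fin normrM ler_wpM2l// /radial_test normrM (ger0_norm (powR_ge0 _ _)).
      by rewrite ler_piMr ?powR_ge0// cutoff_abs.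
    rewrite notin_setE /preimage/= in_itv/= => /negP; rewrite negb_and -!ltNge => h.
    rewrite (radial_test_eq0 e0 ste) ?mulr0 ?normr0//.
    by case/orP: h => /ltW; [left|right].
(* Off [s, t] the factor [cutoff'] vanishes and on it [f] equals the profile, so the integrable [f]
   may stand for [u] before passing to the half-line. *)
have rhsE : rhs = ((K * N%:R)%:E * \int[leb]_r (cutoff' s t e r * f r)%:E)%E.
  have inth : leb.-integrable setT (fun r => (N%:R * (cutoff' s t e r * f r))%:E).
    rewrite (_ : (fun r => _) = fun r => (N%:R%:E * (cutoff' s t e r * f r)%:E)%E).
      exact: integrableZl.
    by apply/funext => r; rewrite EFinM.
  have outside r : r < s \/ t < r -> cutoff' s t e r = 0.
    by case=> /ltW h; [rewrite cutoff'_le|rewrite cutoff'_ge].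
  transitivity (\int[@lebN R N]_(x in normNN @^-1` `[0%R, +oo[)
      (N%:R * (cutoff' s t e (normNN x) * f (normNN x)))%:E)%E.
    rewrite (_ : _ @^-1` _ = setT); last first.
      by apply/seteqP; split => // x _; rewrite /= in_itv/= normNN_ge0.
    apply: eq_integral => x _; rewrite radial_test_divergence//; congr EFin.
    have [xs|sx] := ltP (normNN x) s; first by rewrite outside ?mul0r ?mulr0//; left.
    have [tx|xt] := ltP t (normNN x); first by rewrite outside ?mul0r ?mulr0//; right.
    by rewrite fE// -profileE//; ring.
  rewrite (@integral_normNN _ _ N_gt0 `[0%R, +oo[ (fun r => N%:R * (cutoff' s t e r * f r)))//; last first.
    exact: integrableS inth.
  rewrite [(K * N%:R)%:E]EFinM -muleA; congr (_ * _)%E.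
  rewrite -integralZl// [LHS]integral_mkcond; apply: eq_integral => r _; rewrite patchE.
  case: ifPn => //; rewrite notin_setE/= in_itv/= andbT => /negP; rewrite -ltNge => r0.
  by rewrite outside ?mul0r ?mule0//; left; exact: lt_trans s0.
move: he; move: lhs_le; rewrite lr abseN rhsE.
rewrite -(fineK (integrable_fin_num measurableT int_cf)).
move: (fine _) => c; rewrite -EFinM -EFinB !abse_EFin !lee_fin normrM (gtr0_norm KN0) => h1 h2.
apply: (@le_trans _ _ ((K * N%:R * `|c|)%:E + eta%:E)%E); last exact: leeD2r.
rewrite -EFinD lee_fin.
have h3 : `|f s - f t| <= `|c| + eta / (K * N%:R).
  rewrite -lerBlDl (le_trans _ h2)// (le_trans (lerB_dist _ _))// distrC//.
apply: (le_trans (ler_wpM2l (ltW KN0) h3)).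
by rewrite mulrDr mulrCA divff ?mulr1// lt0r_neq0.
Qed.

End radial_profile.

(** * Spherical averages of radial functions *)

Section spherical_average.
Context {R : realType} {N : nat} (N_gt0 : (0 < N)%N).
Notation leb := (@lebesgue_measure R).
Notation V := (N.-tuple R).
Notation K := (@kappa R N).
Notation W u := (profile N_gt0 u).

Let N0 : 0 < N%:R :> R. Proof. by rewrite ltr0n. Qed.

Lemma omegaN_kappa : omegaN R N = K.
Proof.
rewrite /omegaN (_ : [set x | _] = @normNN R N @^-1` `[0%R, 1%R[).
  rewrite lebN_normNN//.
  rewrite setIidl; last by move=> x; rewrite /= !in_itv/= => /andP[->].
  by rewrite lebesgue_measure_itv/= lte_fin ltr01 -EFinB subr0 mule1.
apply/funext => x; rewrite /preimage/mkset in_itv/= normNN_ge0/=.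
by rewrite /normNN expr_lt1// normN_ge0.
Qed.

Let dir (x : V) : V := scaleN (normN x)^-1 x.

Let measurable_dir : measurable_fun setT dir.
Proof.
apply/measurable_fun_tnthP => i.
rewrite (_ : _ \o _ = fun x : V => normN x `^ (-1) * tnth x i).
  apply: measurable_funM; last exact: measurable_tnth.
  by apply: (@measurableT_comp _ _ _ _ _ _ (@powR R ^~ _)) => //; exact: measurable_normN.
by apply/funext => x /=; rewrite tnth_mktuple powR_inv1// normN_ge0.
Qed.

Let punctured_ball : set V := @normNN R N @^-1` `]0, 1].

Let measurable_punctured_ball : measurable punctured_ball.
Proof. by apply: measurable_preimage_normNN; exact: measurable_itv. Qed.

Let punctured_ballE x : punctured_ball x = (0 < normN x <= 1) :> Prop.
Proof.
rewrite /punctured_ball/preimage/mkset in_itv/= lt_def normNN_ge0 andbT /normNN.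
by rewrite expf_eq0 N_gt0/= expr_le1 ?normN_ge0// lt_def normN_ge0 andbT.
Qed.

(** The cone measure of [sphere_measureN] as a bundled measure, so that integration theory applies:
    N times the image under x -> x/|x| of volume on the punctured unit ball. *)
Let sphere_m : {measure set V -> \bar R} :=
  mscale (NngNum (ltW N0))
    (pushforward_measure (mrestr (@lebN R N) measurable_punctured_ball) measurable_dir).

Let sphere_measureE : @sphere_measureN R N = sphere_m.
Proof.
apply/funext => E; rewrite /sphere_measureN.
transitivity (N%:R%:E * @lebN R N ((dir @^-1` E) `&` punctured_ball))%E => //.
congr (_ * lebN _)%E; rewrite setIC; apply/funext => x.
by rewrite -[RHS]/(punctured_ball x /\ E (dir x)) punctured_ballE.
Qed.

Lemma f_avgN_radial (u : V -> R) (t : R) : radialN u -> 0 < t ->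
  f_avgN (fun x => `|u x|) t = (`|W u (t ^+ N)|)%:E.
Proof.
move=> ru t0; rewrite /f_avgN omegaN_kappa sphere_measureE.
have msph : measurable (@sphereN R N).
  rewrite (_ : @sphereN R N = @normN R N @^-1` [set 1]) //.
  by rewrite -[X in measurable X]setTI; exact: measurable_normN.
transitivity ((N%:R * K)^-1%:E * \int[sphere_m]_(x in @sphereN R N) (cst (`|W u (t ^+ N)|)%:E) x)%E.
  congr (_ * _)%E; apply: eq_integral => x; rewrite inE => x1 /=.
  by rewrite (profileE N_gt0 _ ru) /normNN normN_scale ?(ltW t0)// x1 mulr1.
rewrite integral_cst// (_ : sphere_m (@sphereN R N) = (N%:R * K)%:E).
  have nz : N%:R * K != 0 by rewrite lt0r_neq0// mulr_gt0// kappa_gt0.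
  by rewrite -!EFinM mulrCA mulVf// mulr1.
transitivity (N%:R%:E * @lebN R N ((dir @^-1` @sphereN R N) `&` punctured_ball))%E => //.
rewrite setIidr.
  rewrite lebN_normNN//.
  rewrite setIidl; last by move=> x; rewrite /= !in_itv/= andbT => /andP[/ltW].
  by rewrite lebesgue_measure_itv/= lte_fin ltr01 -EFinB subr0 mule1 EFinM.
move=> x; rewrite punctured_ballE => /andP[x0 _].
by rewrite /dir/preimage/sphereN/= normN_scale ?invr_ge0 ?normN_ge0// mulVf// lt0r_neq0.
Qed.

(** The exceptional set is null in the radius t, but must be null in s = t^N. The change of variable
    goes through R^N: the points whose norm is exceptional form a null set by [lebN_normN_null], and
    [lebN_normNN] reads the same set in the variable s. *)
Lemma cont_rep_ae (u : V -> R) (F : R -> R) : radialN u -> cont_rep_f_abs u F ->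
  {ae leb, forall s, 0 < s -> F (s `^ N%:R^-1) = `|W u s|}.
Proof.
move=> ru [_ [Z [mZ Z0 hZ]]].
pose Z1 := Z `&` `]0%R, +oo[.
have mZ1 : measurable Z1 by apply: measurableI => //; exact: measurable_itv.
have Z1null : @lebN R N (@normN R N @^-1` Z1) = 0%E.
  apply: lebN_normN_null => //.
    by rewrite /Z1 /= in_itv/= ltxx => -[].
  apply/eqP; rewrite -measure_le0 -Z0; apply: le_measure; rewrite ?inE//.
  exact: subIsetl.
pose Z2 := (fun s : R => s `^ N%:R^-1) @^-1` Z1.
have mZ2 : measurable Z2.
  by rewrite -[Z2]setTI; apply: measurable_powR.
exists (Z2 `&` `[0%R, +oo[); split.
- by apply: measurableI => //; exact: measurable_itv.
- have := lebN_normNN N_gt0 mZ2.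
  rewrite (_ : normNN @^-1` Z2 = @normN R N @^-1` Z1); last first.
    apply/funext => x; rewrite /Z2 /preimage/mkset powR_expn_root//; exact: normN_ge0.
  rewrite Z1null => /esym/eqP; rewrite mule_eq0 eqe gt_eqF ?kappa_gt0//= => /eqP.
  by [].
- move=> s /= /not_implyP[s0 hs]; split; last by rewrite /= in_itv/= ltW.
  rewrite /Z2/Z1/=; split; last by rewrite in_itv/= powR_gt0.
  apply: hZ => /= /(_ (powR_gt0 _ s0)); rewrite f_avgN_radial ?powR_gt0//.
  by rewrite powR_root_expn ?(ltW s0)// => -[].
Qed.

Lemma ae_exists_itv (P : R -> Prop) (a b : R) : a < b -> {ae leb, forall x, P x} ->
  exists2 x, a < x < b & P x.
Proof.
move=> ab [Z [mZ Z0 hZ]]; apply: contrapT => noP.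
have : (leb `]a, b[ <= leb Z)%E.
  apply: le_measure; rewrite ?inE//.
  move=> x; rewrite /= in_itv/= => xab; apply: hZ => /= Px; apply: noP.
  by exists x.
by rewrite Z0 lebesgue_measure_itv/= lte_fin ab -EFinB lee_fin subr_le0 leNgt ab.
Qed.

(** The point [t] itself may be exceptional. Continuity of F spreads F < e to a neighbourhood, and
    any interval of positive length in it contains a good point where F and |W| agree. Leaving [a]
    and [b] free allows the search on either side of [t]. *)
Lemma small_profile_near (u : V -> R) (F : R -> R) (t e : R) :
  radialN u -> L1locN u -> cont_rep_f_abs u F -> 0 < t -> F t < e ->
  exists2 d : R, 0 < d < t & forall a b : R, t - d <= a -> a < b -> b <= t + d ->
    exists s, [/\ a ^+ N < s < b ^+ N, good N_gt0 u s & `|W u s| < e].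
Proof.
move=> ru lu FF t0 Fte.
have [d d0 hd] : exists2 d : R, 0 < d & forall r, 0 < r -> `|r - t| < d -> F r < e.
  have /subspace_continuousP/(_ t t0)/cvgrPdist_lt /(_ (e - F t)) := FF.1.
  rewrite subr_gt0 => /(_ Fte)[d /= d0 hd]; exists d => // r r0 rt.
  have := hd r; rewrite /= distrC => /(_ rt r0).
  by rewrite ltr_norml => /andP[+ _]; rewrite opprB ltrD2l ltrN2.
pose d1 := Num.min d t / 2.
have m0 : 0 < Num.min d t by rewrite lt_min d0.
have d1m : d1 < Num.min d t by rewrite /d1; lra.
have := d1m; rewrite lt_min => /andP[d1d d1t].
have d10 : 0 < d1 by rewrite divr_gt0.
exists d1; first by rewrite d10.
move=> a b ta ab bt; have a0 : 0 < a by lra.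
have abN : a ^+ N < b ^+ N by rewrite ltr_pXn2r// nnegrE; lra.
have aeP : {ae leb, forall s, good N_gt0 u s /\ (0 < s -> F (s `^ N%:R^-1) = `|W u s|)}.
  apply: negligibleS (negligibleU (ae_good N_gt0 ru lu) (cont_rep_ae ru FF)) => s /= h.
  apply: contrapT => /not_orP[/contrapT h1 /contrapT h2].
  exact: h.
have [s sab [gs Fs]] := ae_exists_itv abN aeP.
have /andP[as_ sb] := sab.
have s0 : 0 < s by rewrite (lt_trans _ as_)// exprn_gt0.
exists s; split => //; rewrite -Fs//; apply: hd; first exact: powR_gt0.
have sa : a < s `^ N%:R^-1.
  rewrite -[ltLHS](powR_expn_root N_gt0 (ltW a0)); apply: gt0_ltr_powR => //.
  - by rewrite invr_gt0.
  - by rewrite nnegrE exprn_ge0// ltW.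
  - by rewrite nnegrE ltW.
have b0 := lt_trans a0 ab.
have sb' : s `^ N%:R^-1 < b.
  rewrite -[ltRHS](powR_expn_root N_gt0 (ltW b0)); apply: gt0_ltr_powR => //.
  - by rewrite invr_gt0.
  - by rewrite nnegrE ltW.
  - by rewrite nnegrE exprn_ge0// ltW.
by rewrite ltr_norml; apply/andP; split; lra.
Qed.

Lemma small_profile_pinfty (u : V -> R) (e M : R) : radialN u -> tW11loc_minus u ->
  0 < e -> exists s, [/\ M < s, good N_gt0 u s & `|W u s| < e].
Proof.
move=> ru [[lu _] [F [FF [hF _]]]] e0.
(* With t > 1 one has t <= t^N, so points to the right of t^N exceed M. *)
have [t [Mt Fte]] := hF e e0 (Num.max M 1).
move: Mt; rewrite gt_max => /andP[Mt t1].
have t0 : 0 < t by exact: lt_trans t1.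
have [d /andP[d0 dt] hd] := small_profile_near ru lu FF t0 Fte.
have [||//|s [/andP[ts _] gs Ws]] := hd t (t + d); [lra|lra|].
exists s; split => //; apply: lt_trans ts; apply: lt_le_trans Mt _.
by apply: ler_eXnr => //; exact: ltW.
Qed.

Lemma small_profile_0plus (u : V -> R) (e M : R) : radialN u -> tW11loc_plus u ->
  0 < e -> 0 < M -> exists s, [/\ 0 < s < M, good N_gt0 u s & `|W u s| < e].
Proof.
move=> ru [[lu _] [F [FF [hF _]]]] e0 M0.
(* With t < 1 one has t^N <= t, so points to the left of t^N stay below M. *)
have M1 : 0 < Num.min M 1 by rewrite lt_min M0 ltr01.
have [t [/andP[t0 tM] Fte]] := hF e e0 _ M1.
move: tM; rewrite lt_min => /andP[tM t1].
have [d /andP[d0 dt] hd] := small_profile_near ru lu FF t0 Fte.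
have [||//|s [/andP[ts st] gs Ws]] := hd (t - d) t; [lra|lra|lra|].
exists s; split => //; apply/andP; split.
  by apply: le_lt_trans ts; rewrite exprn_ge0//; lra.
apply: lt_trans st _; apply: le_lt_trans tM.
by apply: ler_iXnr => //; exact: ltW.
Qed.

End spherical_average.

(** * Bounds on the mass of the radial derivative over an annulus *)

Section weighted_mass_bounds.
Context {R : realType} {N : nat} (N_gt0 : (0 < N)%N).
Notation leb := (@lebesgue_measure R).
Notation V := (N.-tuple R).
Notation K := (@kappa R N).
Variable gamma : R.

(** The exponent for which (|x|^N)^(-decay) is the weight |x|^(N-1+gamma); its sign separates the
    two cases of the theorem. *)
Definition decay : R := (1 - N%:R - gamma) / N%:R.

Definition weighted (p : R) (g : V -> R) (x : V) : R :=
  normN x `^ (gamma + N%:R * (1 - p^-1)) * g x.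

Let N0 : 0 < N%:R :> R. Proof. by rewrite ltr0n. Qed.

Lemma powR_normNN (x : V) (c : R) : normNN x `^ c = normN x `^ (N%:R * c).
Proof. by rewrite /normNN -powR_mulrn ?normN_ge0// -powRrM. Qed.

Variables (g : V -> R) (mg : measurable_fun setT g) (s t : R) (s0 : 0 < s) (st : s < t).

Let normN_gt0 (x : V) : s <= normNN x -> 0 < normN x.
Proof.
move=> sx; rewrite lt_def normN_ge0 andbT; apply: contraTneq sx => x0.
by rewrite /normNN x0 expr0n gtn_eqF// -ltNge.
Qed.

Let measurable_powR_normN (c : R) : measurable_fun setT (fun x : V => normN x `^ c).
Proof.
by apply: (@measurableT_comp _ _ _ _ _ _ (@powR R ^~ c)) => //; exact: measurable_normN.
Qed.

Let measurable_weighted p : measurable_fun setT (weighted p g).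
Proof. exact: measurable_funM. Qed.

Let mD : measurable (@normNN R N @^-1` `[s, t]).
Proof. exact: measurable_preimage_normNN. Qed.

(** Pairing of L^1 with L^infinity, since |x|^(1-N) = (|x|^N)^decay |x|^gamma. No power is
    integrated, so decay = 0 is allowed. *)
Lemma weighted_mass_le1 (c : R) : (forall r, s <= r <= t -> r `^ decay <= c) ->
  (weighted_mass g `[s, t] <= c%:E * LpN 1 (weighted 1 g))%E.
Proof.
move=> hc.
have c0 : 0 <= c by rewrite (le_trans (powR_ge0 s decay))// hc// lexx ltW.
rewrite /LpN invr1 poweRe1; last by apply: integral_ge0 => x _; rewrite lee_fin powR_ge0.
have mw : measurable_fun setT (fun x : V => (`|weighted 1 g x| `^ 1)%:E).
  apply/measurable_EFinP; apply: (@measurableT_comp _ _ _ _ _ _ (@powR R ^~ 1)) => //.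
  exact: measurableT_comp.
have f0 (x : V) : setT x -> (0 <= (`|weighted 1 g x| `^ 1)%:E)%E.
  by move=> _; rewrite lee_fin powR_ge0.
have c0' : (0 <= c%:E)%E by rewrite lee_fin.
rewrite -(ge0_integralZl _ measurableT mw f0 c0').
rewrite /weighted_mass [leLHS]integral_mkcond; apply: ge0_le_integral => //.
- by move=> x _; apply: erestrict_ge0 => {}x _; rewrite lee_fin mulr_ge0// powR_ge0.
- by apply/(measurable_restrictT _ _).1 => //; apply: measurable_funTS; apply/measurable_EFinP;
    apply: measurable_funM => //; exact: measurableT_comp.
- by apply: measurable_funeM.
move=> x _; rewrite patchE; case: ifPn => [|_]; last by rewrite mule_ge0// lee_fin powR_ge0.
rewrite inE /preimage/= in_itv/= => xst; have /andP[sx xt] := xst.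
rewrite -EFinM lee_fin powRr1// /weighted invr1 subrr mulr0 addr0.
rewrite normrM (ger0_norm (powR_ge0 _ _)) mulrA [leRHS]mulrC ler_wpM2l//.
have -> : normN x `^ (1 - N%:R) = normNN x `^ decay * normN x `^ gamma.
  rewrite powR_normNN -powRD ?(lt0r_neq0 (normN_gt0 sx)) ?implybT//.
  by congr powR; rewrite /decay; field; exact: lt0r_neq0.
by rewrite ler_wpM2r ?powR_ge0// hc.
Qed.

Lemma integral_powR (b : R) : b != 0 ->
  (\int[leb]_(r in `[s, t]) (r `^ (b - 1))%:E = ((t `^ b - s `^ b) / b)%:E)%E.
Proof.
move=> b0.
have d (r : R) : 0 < r -> is_derive r 1 (fun r => b^-1 * r `^ b) (r `^ (b - 1)).
  move=> r0; have := is_deriveZ b^-1 (is_derive1_powR b r0).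
  by rewrite /GRing.scale/= mulKf.
have c (e r : R) : 0 < r -> {for r, continuous (fun r => r `^ e)}.
  move=> r0; apply: differentiable_continuous; apply/derivable1_diffP.
  by case: (is_derive1_powR e r0).
have c' (r : R) : 0 < r -> {for r, continuous (fun r => b^-1 * r `^ b)}.
  by move=> r0; apply: cvgM; [exact: cvg_cst|exact: c].
have t0 := lt_trans s0 st.
rewrite (@continuous_FTC2 _ _ (fun r => b^-1 * r `^ b))//.
- by rewrite -EFinB -mulrBr mulrC.
- apply: continuous_in_subspaceT => r; rewrite inE/= in_itv/= => /andP[sr _].
  by apply: c; exact: lt_le_trans sr.
- split.
  + by move=> r; rewrite in_itv/= => /andP[sr _]; case: (d r (lt_trans s0 sr)).
  + by apply: cvg_at_right_filter; exact: c'.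
  + by apply: cvg_at_left_filter; exact: c'.
- by move=> r; rewrite in_itv/= => /andP[sr _]; rewrite derive1E; case: (d r (lt_trans s0 sr)).
Qed.

Lemma weighted_mass_hoelder (p q : R) : 1 < p -> p^-1 + q^-1 = 1 -> decay != 0 ->
  (weighted_mass g `[s, t] <=
   ((K * ((t `^ (decay * q) - s `^ (decay * q)) / (decay * q))) `^ q^-1)%:E *
   LpN p (weighted p g))%E.
Proof.
move=> p1 pq a0.
have p0 : 0 < p by exact: lt_trans p1.
have q0 : 0 < q by rewrite -invr_gt0; have := invf_lt1 p0; rewrite p1; lra.
(* The exponent complements the weight of [g] to |x|^(1-N), and its q-th power is (|x|^N)^(decay q -
   1), so the dual norm reduces to a one-dimensional power integral. *)
pose h (x : V) : R := \1_(normNN @^-1` `[s, t]) x * normN x `^ (1 - N%:R - gamma - N%:R / q).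
have mh : measurable_fun setT h by exact: measurable_funM.
have := hoelder (@lebN R N) (measurable_weighted p) mh p0 q0 pq.
rewrite Lnorm1 [in X in (_ <= X)%E]muleC.
have -> : (\int[@lebN R N]_x `|(EFin \o (weighted p g \* h)%R) x| = weighted_mass g `[s, t])%E.
  rewrite /weighted_mass [RHS]integral_mkcond; apply: eq_integral => x _.
  rewrite patchE /= /h indicE; case: ifPn => [|_]; last by rewrite mul0r mulr0 normr0.
  rewrite inE /preimage/= in_itv/= mul1r => /andP[sx _].
  have E : normN x `^ (gamma + N%:R * (1 - p^-1)) * normN x `^ (1 - N%:R - gamma - N%:R / q) =
      normN x `^ (1 - N%:R).
    rewrite -powRD ?(lt0r_neq0 (normN_gt0 sx)) ?implybT//; congr powR.
    have -> : 1 - p^-1 = q^-1 by rewrite -pq; ring.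
    by ring.
  by rewrite /weighted mulrAC E normrM (ger0_norm (powR_ge0 _ _)) mulrC.
have -> : ('N[@lebN R N]_p%:E[EFin \o weighted p g] = LpN p (weighted p g))%E.
  by rewrite unlock /LpN.
congr (_ <= _ * _)%E.
rewrite unlock -poweR_EFin; congr (_ `^ _)%E.
rewrite EFinM -integral_powR; last by rewrite mulf_neq0// lt0r_neq0.
have D0 : `[s, t] `<=` `[0, +oo[.
  by move=> r; rewrite /= !in_itv/= andbT => /andP[/(le_trans (ltW s0))].
have mpow : measurable_fun `[s, t] (fun r => (r `^ (decay * q - 1))%:E).
  by apply: measurable_funTS; apply/measurable_EFinP; exact: measurable_powR.
have pow0 : {in `[s, t]%classic, forall r : R, (0 <= (r `^ (decay * q - 1))%:E)%E}.
  by move=> r _; rewrite lee_fin powR_ge0.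
rewrite -(ge0_integral_normNN N_gt0 (measurable_itv _) D0 mpow pow0).
rewrite [RHS]integral_mkcond; apply: eq_integral => x _.
rewrite patchE /= /h indicE; case: ifPn => [|_]; last first.
  by rewrite mul0r normr0 powR0// lt0r_neq0.
rewrite inE /preimage/= in_itv/= mul1r => /andP[sx _].
rewrite ger0_norm ?powR_ge0// -powRrM powR_normNN; congr (_ `^ _)%:E.
by rewrite /decay; field; rewrite !lt0r_neq0.
Qed.

End weighted_mass_bounds.

(** * From mass bounds to the essential supremum *)

Section pointwise_decay.
Context {R : realType} {N : nat} (N_gt0 : (0 < N)%N).
Notation leb := (@lebesgue_measure R).
Notation V := (N.-tuple R).
Notation K := (@kappa R N).
Notation W u := (profile N_gt0 u).
Variables (gamma p : R) (u g : V -> R).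
Hypotheses (ru : radialN u) (lu : L1locN u) (lg : L1locN g) (dug : radial_derivN u g).

Let KN0 : 0 < K * N%:R. Proof. by rewrite mulr_gt0 ?kappa_gt0// ltr0n. Qed.

Notation decay := (@decay R N gamma).
Notation L := (LpN p (weighted gamma p g)).

Lemma sup_bound (A : R) : 0 < A ->
  (forall s, 0 < s -> good N_gt0 u s ->
    ((K * N%:R * `|W u s|)%:E <= (A * s `^ decay)%:E * L)%E) ->
  (LinfN (fun x => normN x `^ (N%:R - 1 + gamma) * u x)%R <= (A / (K * N%:R))%:E * L)%E.
Proof.
move=> A0 hW; apply: ereal_inf_lbound => /=.
have [Z [mZ Z0 hZ]] := ae_good N_gt0 ru lu.
(* The origin joins the exceptional set because the bound on the profile is available at positive
   arguments only. *)
exists (normNN @^-1` (Z `|` [set 0])); split.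
  by apply: measurable_preimage_normNN; exact: measurableU.
split.
  rewrite lebN_normNN//; last exact: measurableU.
  rewrite (_ : leb _ = 0)%E ?mule0//; apply/eqP; rewrite -measure_le0.
  apply: (@le_trans _ _ (leb (Z `|` [set 0]))).
    apply: le_measure; rewrite ?inE; last exact: subIsetl.
      by apply: measurableI; [exact: measurableU|exact: measurable_itv].
    exact: measurableU.
  apply: (@le_trans _ _ (leb Z + leb [set 0%R])%E); first exact: measureU2.
  by rewrite Z0 lebesgue_measure_set1 adde0.
move=> x /= hx; have [x0|x0] := eqVneq (normNN x) 0; first by right.
left; apply: hZ => /= gx; move: hx; apply/negP; rewrite -leNgt.
have s0 : 0 < normNN x by rewrite lt_def x0 normNN_ge0.
have r0 : 0 < normN x.
  rewrite lt_def normN_ge0 andbT; apply: contraNneq x0 => r0.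
  by rewrite /normNN r0 expr0n gtn_eqF.
have E : normN x `^ (N%:R - 1 + gamma) = normNN x `^ (- decay).
  rewrite powR_normNN /decay; congr powR; field.
  by rewrite pnatr_eq0 -lt0n.
rewrite (profileE N_gt0 x ru) normrM (ger0_norm (powR_ge0 _ _)) E.
have c0 : 0 <= normNN x `^ (- decay) / (K * N%:R) by rewrite divr_ge0 ?powR_ge0// ltW.
have := @lee_wpmul2l R (normNN x `^ (- decay) / (K * N%:R))%:E _ _ _ (hW _ s0 gx).
rewrite lee_fin => /(_ c0); rewrite muleA -!EFinM.
rewrite mulrA divfK ?(lt0r_neq0 KN0)//.
rewrite (_ : _ / _ * (A * _) = A / (K * N%:R))//.
have h1 : normNN x `^ decay != 0 by rewrite lt0r_neq0// powR_gt0.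
have h2 : K != 0 by rewrite lt0r_neq0// kappa_gt0.
have h3 : N%:R != 0 :> R by rewrite pnatr_eq0 -lt0n.
by rewrite powRN; field; rewrite h1 h2 h3.
Qed.

Lemma decay_minus (A : R) : 0 < A -> tW11loc_minus u ->
  (forall s t, 0 < s -> s < t -> (weighted_mass g `[s, t] <= (A * s `^ decay)%:E * L)%E) ->
  (LinfN (fun x => normN x `^ (N%:R - 1 + gamma) * u x)%R <= (A / (K * N%:R))%:E * L)%E.
Proof.
move=> A0 um hm; apply: sup_bound => // s s0 gs.
apply/lee_addgt0Pr => e e0.
(* The increment is bounded with the factor K N, so a value of |W t| below e/(K N) costs at most
   e. *)
have e1 : 0 < e / (K * N%:R) by rewrite divr_gt0.
have [t [ts gt /ltW Wt]] := small_profile_pinfty N_gt0 s ru um e1.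
have h := le_trans (profile_increment ru lu lg.1 dug s0 ts gs gt) (hm _ _ s0 ts).
apply: le_trans (leeD2r _ h); rewrite -EFinD lee_fin.
rewrite -lerBlDl -mulrBr mulrC -ler_pdivlMr// (le_trans _ Wt)//.
by rewrite lerBlDr -lerBlDl (le_trans (lerB_dist _ _)).
Qed.

Lemma decay_plus (A : R) : 0 < A -> tW11loc_plus u ->
  (forall s t, 0 < s -> s < t -> (weighted_mass g `[s, t] <= (A * t `^ decay)%:E * L)%E) ->
  (LinfN (fun x => normN x `^ (N%:R - 1 + gamma) * u x)%R <= (A / (K * N%:R))%:E * L)%E.
Proof.
move=> A0 up hm; apply: sup_bound => // s s0 gs.
apply/lee_addgt0Pr => e e0.
have e1 : 0 < e / (K * N%:R) by rewrite divr_gt0.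
have [t [/andP[t0 ts] gt /ltW Wt]] := small_profile_0plus N_gt0 ru up e1 s0.
have h := le_trans (profile_increment ru lu lg.1 dug t0 ts gt gs) (hm _ _ t0 ts).
apply: le_trans (leeD2r _ h); rewrite -EFinD lee_fin.
rewrite -lerBlDl -mulrBr mulrC -ler_pdivlMr// (le_trans _ Wt)//.
by rewrite distrC lerBlDr -lerBlDl (le_trans (lerB_dist _ _)).
Qed.

End pointwise_decay.

(** * Explicit constants *)

Section main_bounds.
Context {R : realType} {N : nat} (N_gt0 : (0 < N)%N).
Notation V := (N.-tuple R).
Notation K := (@kappa R N).
Variables (gamma : R).
Notation decay := (@decay R N gamma).

Let N0 : 0 < N%:R :> R. Proof. by rewrite ltr0n. Qed.

Lemma decay_lt0 : (decay < 0) = (1 - N%:R < gamma).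
Proof. by rewrite /decay pmulr_llt0 ?invr_gt0// subr_lt0. Qed.

Lemma decay_gt0 : (0 < decay) = (gamma < 1 - N%:R).
Proof. by rewrite /decay pmulr_lgt0 ?invr_gt0// subr_gt0. Qed.

Lemma powR_decay_le0 (c s r : R) : c <= 0 -> 0 < s -> s <= r -> r `^ c <= s `^ c.
Proof.
move=> c0 s0 sr; rewrite -[c]opprK 2!(powRN _ (- c)).
have r0 := lt_le_trans s0 sr.
rewrite lef_pV2 ?posrE ?powR_gt0//; apply: ge0_ler_powR; rewrite ?nnegrE ?oppr_ge0//; exact: ltW.
Qed.

Lemma mass_minus1 (g : V -> R) (s t : R) : measurable_fun setT g -> decay <= 0 ->
  0 < s -> s < t ->
  (weighted_mass g `[s, t] <= (1 * s `^ decay)%:E * LpN 1 (weighted gamma 1 g))%E.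
Proof.
move=> mg a0 s0 st; rewrite mul1r; apply: weighted_mass_le1 => // r /andP[sr _].
exact: powR_decay_le0.
Qed.

Lemma mass_plus1 (g : V -> R) (s t : R) : measurable_fun setT g -> 0 <= decay ->
  0 < s -> s < t ->
  (weighted_mass g `[s, t] <= (1 * t `^ decay)%:E * LpN 1 (weighted gamma 1 g))%E.
Proof.
move=> mg a0 s0 st; rewrite mul1r; apply: weighted_mass_le1 => // r /andP[sr rt].
by apply: ge0_ler_powR; rewrite ?nnegrE// ltW// (lt_le_trans s0)// (le_trans sr).
Qed.

Variables (p q : R) (p1 : 1 < p) (pq : p^-1 + q^-1 = 1).

(** For decay < 0 the integral of r^(decay q - 1) over [s, infinity) is s^(decay q) / (|decay| q),
    and symmetrically over (0, t] for decay > 0; the constant is what the q-th root leaves besides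
    the power of the endpoint. *)
Definition hoelder_cst : R := (K / (`|decay| * q)) `^ q^-1.

Let q0 : 0 < q.
Proof.
rewrite -invr_gt0; have := invf_lt1 (lt_trans ltr01 p1); rewrite p1.
by move: pq; lra.
Qed.

Lemma hoelder_cst_gt0 : decay != 0 -> 0 < hoelder_cst.
Proof. by move=> a0; rewrite powR_gt0// divr_gt0 ?kappa_gt0// mulr_gt0// normr_gt0. Qed.

Let cst_powR (y : R) : 0 < y ->
  (K / (`|decay| * q) * y `^ (decay * q)) `^ q^-1 = hoelder_cst * y `^ decay.
Proof.
move=> y0; have c0 : 0 <= K / (`|decay| * q).
  by rewrite divr_ge0 ?mulr_ge0// ltW// kappa_gt0.
by rewrite powRM ?powR_ge0// -powRrM mulfK// lt0r_neq0.
Qed.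

(** Common to both signs: [y] is the endpoint whose power dominates, s for decay < 0 and t for decay
    > 0, the other power being dropped. *)
Let mass_hoelder (g : V -> R) (s t y : R) : measurable_fun setT g -> decay != 0 ->
  0 < s -> s < t -> 0 < y ->
  0 <= (t `^ (decay * q) - s `^ (decay * q)) / (decay * q) <= y `^ (decay * q) / (`|decay| * q) ->
  (weighted_mass g `[s, t] <= (hoelder_cst * y `^ decay)%:E * LpN p (weighted gamma p g))%E.
Proof.
move=> mg a0 s0 st y0 /andP[h0 h1].
apply: (le_trans (weighted_mass_hoelder N_gt0 mg s0 st p1 pq a0)).
apply: lee_wpmul2r; first exact: poweR_ge0.
rewrite lee_fin -cst_powR//; have K0 := @kappa_gt0 R N.
apply: ge0_ler_powR; rewrite ?nnegrE ?invr_ge0 ?(ltW q0)//.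
- by apply: mulr_ge0; [exact: ltW|].
- by apply: mulr_ge0; [apply: divr_ge0; [exact: ltW|apply: mulr_ge0; [|exact: ltW]]|exact: powR_ge0].
by rewrite -mulrA ler_pM2l// [leRHS]mulrC.
Qed.

Lemma mass_minus (g : V -> R) (s t : R) : measurable_fun setT g -> decay < 0 ->
  0 < s -> s < t ->
  (weighted_mass g `[s, t] <= (hoelder_cst * s `^ decay)%:E * LpN p (weighted gamma p g))%E.
Proof.
move=> mg a0 s0 st; apply: mass_hoelder => //; first by rewrite lt_eqF.
have aq : decay * q < 0 by rewrite pmulr_llt0.
have b0 : 0 < - decay * q by rewrite mulNr oppr_gt0.
rewrite (ltr0_norm a0).
have -> : (t `^ (decay * q) - s `^ (decay * q)) / (decay * q) =
    (s `^ (decay * q) - t `^ (decay * q)) / (- decay * q).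
  by rewrite mulNr invrN mulrN -mulNr opprB.
rewrite divr_ge0 ?(ltW b0) ?subr_ge0//=.
  by rewrite ler_pM2r ?invr_gt0// gerBl powR_ge0.
by apply: powR_decay_le0 => //; exact: ltW.
Qed.

Lemma mass_plus (g : V -> R) (s t : R) : measurable_fun setT g -> 0 < decay ->
  0 < s -> s < t ->
  (weighted_mass g `[s, t] <= (hoelder_cst * t `^ decay)%:E * LpN p (weighted gamma p g))%E.
Proof.
move=> mg a0 s0 st; have t0 := lt_trans s0 st.
apply: mass_hoelder => //; first by rewrite gt_eqF.
have aq : 0 < decay * q by rewrite mulr_gt0.
rewrite (gtr0_norm a0) divr_ge0 ?(ltW aq) ?subr_ge0//=.
  by rewrite ler_pM2r ?invr_gt0// gerBl powR_ge0.
by apply: ge0_ler_powR; rewrite ?nnegrE ltW.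
Qed.

End main_bounds.

Theorem theorem3p6 (R : realType) (N : nat) (gamma p : R) :
  (0 < N)%N -> 1 <= p ->
  (exists C : R, 0 < C /\
    forall u g : N.-tuple R -> R,
      radialN u -> L1locN u -> L1locN g -> radial_derivN u g ->
      ((1 - N%:R < gamma /\ tW11loc_minus u) \/
       (gamma < 1 - N%:R /\ tW11loc_plus u)) ->
      (LinfN (fun x => (normN x `^ (N%:R - 1 + gamma) * u x)%R)
        <= C%:E * LpN p (fun x => (normN x `^ (gamma + N%:R * (1 - p^-1)) * g x)%R))%E)
  /\
  (p = 1 -> gamma = 1 - N%:R ->
   exists C : R, 0 < C /\
    forall u g : N.-tuple R -> R,
      radialN u -> L1locN u -> L1locN g -> radial_derivN u g ->
      (tW11loc_minus u \/ tW11loc_plus u) ->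
      (LinfN (fun x => (normN x `^ (N%:R - 1 + gamma) * u x)%R)
        <= C%:E * LpN p (fun x => (normN x `^ (gamma + N%:R * (1 - p^-1)) * g x)%R))%E).
Proof.
move=> N_gt0 p_ge1; have KN0 : 0 < @kappa R N * N%:R by rewrite mulr_gt0 ?kappa_gt0// ltr0n.
split; last first.
  move=> -> gammaE; have a0 : @decay R N gamma = 0 by rewrite /decay gammaE subrr mul0r.
  (* The reciprocal of the area of the unit sphere; at decay = 0 the mass bounds for both ends hold
     with constant 1. *)
  exists (1 / (@kappa R N * N%:R)); split; first exact: divr_gt0.
  move=> u g ru lu lg dug [um|up].
    by apply: decay_minus => // s t; apply: mass_minus1 => //; [exact: lg.1|rewrite a0].
  by apply: decay_plus => // s t; apply: mass_plus1 => //; [exact: lg.1|rewrite a0].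
move: p_ge1; rewrite le_eqVlt => /predU1P[<-|p1].
  exists (1 / (@kappa R N * N%:R)); split; first exact: divr_gt0.
  move=> u g ru lu lg dug [[h um]|[h up]].
    apply: decay_minus => // s t; apply: mass_minus1 => //; first exact: lg.1.
    by rewrite ltW// decay_lt0.
  apply: decay_plus => // s t; apply: mass_plus1 => //; first exact: lg.1.
  by rewrite ltW// decay_gt0.
pose q := (1 - p^-1)^-1; have pq : p^-1 + q^-1 = 1 by rewrite invrK subrKC.
(* The constant is chosen before the alternative is known and the Hoelder constant needs decay
   nonzero; for gamma = 1 - N both strict inequalities fail, so any constant will do. *)
have [gammaE|gamma_neq] := eqVneq gamma (1 - N%:R).
  by exists 1; split => // u g _ _ _ _; rewrite gammaE ltxx => -[[]|[]].
have a0 : @decay R N gamma != 0.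
  by rewrite /decay mulf_neq0 ?invr_eq0 ?pnatr_eq0 -?lt0n// subr_eq0 eq_sym.
exists (@hoelder_cst R N gamma q / (@kappa R N * N%:R)).
split; first by rewrite divr_gt0// (hoelder_cst_gt0 p1 pq).
move=> u g ru lu lg dug [[h um]|[h up]].
  apply: decay_minus => //; first exact: (hoelder_cst_gt0 p1 pq).
  by move=> s t; apply: mass_minus => //; [exact: lg.1|rewrite decay_lt0].
apply: decay_plus => //; first exact: (hoelder_cst_gt0 p1 pq).
by move=> s t; apply: mass_plus => //; [exact: lg.1|rewrite decay_gt0].
Qed.
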